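(* Let $\Delta=[a,b]$ with $a,b\in\mathbb{R}$, $0<a<b$. Assume: (1) for all $t\in\mathbb{Z}$, the conditional density $f^{\mathcal{F}_{t-1}}$ of $X_t$ given $\mathcal{F}_{t-1}$ exists, $f^{\mathcal{F}_{t-1}}\in C_0(\mathbb{R})$, and $f\in C_0(\mathbb{R})$; (2) $\left\|\frac1n\sum_{t=1}^n f^{\mathcal{F}_{t-1}}-f\right\|_0\to 0$ almost surely as $n\to+\infty$; (3) $\lim_{n\to+\infty}\frac{n\,h_n}{\log n}=+\infty$. Then $$\sup_{x\in\Delta}\left|D_n(x)-f(x)\right|\to 0\quad\text{almost surely as } n\to+\infty.$$
   Context: $\{(X_t,Y_t),\,t\in\mathbb{Z}\}$ is a strictly stationary and ergodic $[0,+\infty[^2$-valued stochastic process on a probability space $(\Omega,\mathcal{A},P)$, with absolutely continuous marginal distributions; $f$ is the density of $X_t$. For $t\in\mathbb{Z}$, $\mathcal{F}_t=\sigma\{(X_s,Y_s),\,s\le t\}$. $C_0(\mathbb{R})$ is the space of continuous functions on $\mathbb{R}$ tending to zero at infinity, with the sup-norm $\|\cdot\|_0$. The bandwidth sequence $(h_n)_{n\in\mathbb{N}}$ consists of positive reals with $\lim_{n\to+\infty}h_n=0$. For $x\ge 0$, $K_{\alpha(n,x),\beta(n)}$ is the density of the gamma distribution with shape $\alpha(n,x)=\frac{x}{h_n}+1$ and scale $\beta(n)=h_n$: $$K_{\alpha(n,x),\beta(n)}(y)=\frac{1}{\Gamma(\alpha(n,x))\,\beta(n)^{\alpha(n,x)}}\,y^{\alpha(n,x)-1}e^{-y/\beta(n)}\,\mathbb{1}_{[0,+\infty[}(y),\quad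 y\in\mathbb{R}.$$ The gamma kernel density estimator is $D_n(x)=\frac1n\sum_{t=1}^n K_{\alpha(n,x),\beta(n)}(X_t)$. *)

(* Defs.v *)
From HB Require Import structures.
From mathcomp Require Import all_boot all_order all_algebra.
From mathcomp Require Import all_classical all_reals all_analysis measurable_realfun.

Set Implicit Arguments.
Unset Strict Implicit.
Unset Printing Implicit Defensive.

Import Order.TTheory GRing.Theory Num.Theory.
Import numFieldNormedType.Exports.

Local Open Scope classical_set_scope.
Local Open Scope ring_scope.

Definition strictly_stationary (d d' : measure_display) (T : measurableType d)
    (E : measurableType d') (R : realType) (P : probability T R)
    (Z : int -> T -> E) : Prop :=
  forall (k : nat) (t : 'I_k -> int) (s : int) (A : set (k.-tuple E)),
    measurable A ->
    P [set w | A [tuple Z (t i + s) w | i < k]] =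
    P [set w | A [tuple Z (t i) w | i < k]].

Definition path_sigma_algebra (d' : measure_display) (E : measurableType d') :
    set (set (int -> E)) :=
  <<s [set A | exists (t : int) (B : set E),
         measurable B /\ A = (fun z : int -> E => z t) @^-1` B] >>.

Definition path_shift (E : Type) (z : int -> E) : int -> E :=
  fun t => z (t + 1).

(* For a stationary process: the law of the path is ergodic under the shift. *)
Definition ergodic (d d' : measure_display) (T : measurableType d)
    (E : measurableType d') (R : realType) (P : probability T R)
    (Z : int -> T -> E) : Prop :=
  forall A : set (int -> E), path_sigma_algebra A ->
    @path_shift E @^-1` A = A ->
    P [set w | A (fun t => Z t w)] = 0%E \/ P [set w | A (fun t => Z t w)] = 1%E.

(* sigma-algebra generated by the Z s, s <= t *)
Definition past (d d' : measure_display) (T : measurableType d)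
    (E : measurableType d') (Z : int -> T -> E) (t : int) : set (set T) :=
  <<s [set A | exists (s : int) (B : set E),
         [/\ (s <= t)%R, measurable B & A = Z s @^-1` B]] >>.

Definition is_density (R : realType) (mu : set R -> \bar R) (f : R -> R) :
    Prop :=
  [/\ measurable_fun setT f,
      (forall x, 0 <= f x)
    & forall B : set R, measurable B ->
        mu B = (\int[lebesgue_measure]_(x in B) (f x)%:E)%E].

(* Z is a version of E[W | G], for G a sub-sigma-algebra *)
Definition is_cond_expectation (d : measure_display) (T : measurableType d)
    (R : realType) (P : probability T R) (G : set (set T)) (W Z : T -> \bar R) :
    Prop :=
  [/\ P.-integrable setT Z,
      (forall B : set (\bar R), measurable B -> G (Z @^-1` B))
    & forall C : set T, G C ->
        (\int[P]_(w in C) Z w = \int[P]_(w in C) W w)%E].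

(* The measures with Lebesgue densities g w form a regular conditional
   distribution of X given G.  Joint measurability of g is not required. *)
Definition is_cond_density (d : measure_display) (T : measurableType d)
    (R : realType) (P : probability T R) (G : set (set T)) (X : T -> R)
    (g : T -> R -> R) : Prop :=
  [/\ (forall w, measurable_fun setT (g w)),
      (forall w x, 0 <= g w x)
    & forall B : set R, measurable B ->
        is_cond_expectation P G (fun w => (\1_(X @^-1` B) w)%:E)
          (fun w => (\int[lebesgue_measure]_(x in B) (g w x)%:E)%E)].

Definition C0 (R : realType) (u : R -> R) : Prop :=
  [/\ continuous u,
      u x @[x --> +oo%R] --> (0 : R)
    & u x @[x --> -oo%R] --> (0 : R)].

Definition sup_on (R : realType) (D : set R) (u : R -> R) : \bar R :=
  ereal_sup [set `|u x|%:E | x in D].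

Definition gamma_fun (R : realType) (s : R) : R :=
  \int[lebesgue_measure]_(x in `]0, +oo[) (x `^ (s - 1) * expR (- x)).

Definition gamma_pdf (R : realType) (alpha beta y : R) : R :=
  (gamma_fun alpha * beta `^ alpha)^-1 * y `^ (alpha - 1) * expR (- y / beta) *
  \1_(`[0, +oo[) y.

Definition gamma_kde (d : measure_display) (T : measurableType d)
    (R : realType) (h : nat -> R) (X : int -> T -> R) (n : nat) (w : T)
    (x : R) : R :=
  n%:R^-1 * \sum_(1 <= t < n.+1) gamma_pdf (x / h n + 1) (h n) (X t%:Z w).

(* Main.v *)
Require Import Defs.
From HB Require Import structures.
From mathcomp Require Import all_boot all_order all_algebra finmap.
From mathcomp Require Import all_classical all_reals all_analysis measurable_realfun.
From mathcomp Require Import ring lra.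

(* Write K_m for the gamma density with integer shape m + 1 and scale h.
   Weighted AM-GM and Bernoulli's inequality applied to z ^ theta show that, for
   x = (m + theta) h with theta in [0, 1], the kernel at x lies between
   B ((1 + theta) K_m - theta K_{m-1}) and A ((1 - theta) K_m + theta K_{m+1})
   with A and B tending to 1; integrating the same two inequalities bounds
   Gamma (m + 1 + theta).  So the supremum over [a, b] reduces to polynomially
   many grid points m h.

   At a grid point, kappa_t = h K_m (X_t) takes values in [0, 1].  With
   mu_t = E[kappa_t | F_{t-1}], S = sum kappa_t and M = sum mu_t, the inequality
   e^(l k) <= 1 + (l + 2 l^2) k makes exp (l S - (l + 2 l^2) M) a
   supermartingale, hence |S - M| <= 2 eta M + eta n h outside an event of
   probability 2 exp (- eta^2 n h).  As n h / log n -> oo, these probabilities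
   are summable over n and the grid, and Borel-Cantelli applies.

   Finally M / (n h) is the integral of K_m against the averaged conditional
   density, which is uniformly close to f, and K_m has mass 1 and second moment
   h^2 (m + 2) about m h. *)

Set Implicit Arguments.
Unset Strict Implicit.
Unset Printing Implicit Defensive.

Import Order.TTheory GRing.Theory Num.Theory.
Import numFieldNormedType.Exports.

Local Open Scope classical_set_scope.
Local Open Scope ring_scope.

(** * Gamma kernels with integer shape *)

Section PowerTangents.
Variable R : realType.
Implicit Types (z l theta : R).

(** Concavity of the power: its graph lies below the tangent at [l]. With [s = ln (z / l)], the
    tangent of [expR] at [theta * s] bounds both [expR s] and 1 from below; the weights [theta] and
    [1 - theta] cancel the terms linear in [s]. *)
Lemma powR_le_tangent z l theta : 0 <= z -> 0 < l -> 0 <= theta <= 1 ->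
  z `^ theta <= l `^ theta * (1 - theta + theta * (z / l)).
Proof.
move=> z0 l0 /andP[t0 t1].
have [->|zn0] := eqVneq z 0.
  rewrite mul0r mulr0 addr0.
  have [->|tn0] := eqVneq theta 0; first by rewrite !powRr0 subr0 mul1r.
  by rewrite powR0// mulr_ge0 ?powR_ge0// subr_ge0.
have z_gt0 : 0 < z by rewrite lt_def zn0.
pose u := z / l.
have u0 : 0 < u by rewrite divr_gt0.
have -> : z = l * u by rewrite /u mulrC divfK// gt_eqF.
rewrite powRM ?(ltW l0) ?(ltW u0)// ler_wpM2l ?powR_ge0//.
rewrite (mulrC l) mulfK ?gt_eqF//.
rewrite {1}/powR gt_eqF//.
have uE : u = expR (ln u) by rewrite lnK// posrE.
set s := ln u in uE *.
rewrite uE.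
have E1 : expR s = expR (theta * s) * expR ((1 - theta) * s).
  by rewrite -expRD; congr expR; ring.
have E2 : 1 = expR (theta * s) * expR (- (theta * s)).
  by rewrite -expRD subrr expR0.
have H1 := expR_ge1Dx ((1 - theta) * s).
have H2 := expR_ge1Dx (- (theta * s)).
set v := expR (theta * s) in E1 E2 *.
have v0 : 0 <= v by exact: expR_ge0.
have K1 : v * (1 + (1 - theta) * s) <= expR s by rewrite E1 ler_wpM2l.
have K2 : v * (1 - theta * s) <= 1 by rewrite [leRHS]E2 ler_wpM2l.
have K3 := ler_wpM2l t0 K1.
have t1' : 0 <= 1 - theta by rewrite subr_ge0.
have K4 := ler_wpM2l t1' K2.
clear E1 E2; lra.
Qed.

(** The power of exponent [1 + theta] is convex and lies above its tangent at [l]. The extra factor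
    [z] is kept apart because it will raise the index of a Poisson weight. *)
Lemma powR_ge_tangent z l theta : 0 <= z -> 0 < l -> 0 <= theta ->
  l `^ theta * ((1 + theta) * z - theta * l) <= z * z `^ theta.
Proof.
move=> z0 l0 t0.
have [->|zn0] := eqVneq z 0.
  by rewrite mul0r mulr0 add0r mulr_ge0_le0 ?powR_ge0// oppr_le0 mulr_ge0// ltW.
have z_gt0 : 0 < z by rewrite lt_def zn0.
pose u := z / l.
have u0 : 0 < u by rewrite divr_gt0.
have -> : z = l * u by rewrite /u mulrC divfK// gt_eqF.
rewrite powRM ?(ltW l0) ?(ltW u0)//.
have -> : l * u * (l `^ theta * u `^ theta) = l `^ theta * (l * (u * u `^ theta)).
  by ring.
have -> : (1 + theta) * (l * u) - theta * l = l * ((1 + theta) * u - theta) by ring.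
rewrite ler_wpM2l ?powR_ge0// ler_wpM2l ?(ltW l0)//.
rewrite {1}/powR gt_eqF//.
have uE : u = expR (ln u) by rewrite lnK// posrE.
set s := ln u in uE *.
have K1 : u * (1 + theta * s) <= u * expR (theta * s).
  by rewrite ler_wpM2l ?(ltW u0)// expR_ge1Dx.
have E2 : 1 = u * expR (- s) by rewrite uE -expRD subrr expR0.
have K2 : u * (1 - s) <= 1 by rewrite [leRHS]E2 ler_wpM2l ?(ltW u0)// expR_ge1Dx.
have K3 := ler_wpM2l t0 K2.
clear E2; lra.
Qed.

End PowerTangents.

(** * Poisson weights and gamma densities of integer shape *)

Section PoissonWeights.
Variable R : realType.
Implicit Types (z y h theta : R) (m : nat).

(** The Poisson probability of [m] with mean [z]; as a function of [z >= 0], the gamma density with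
    shape [m + 1] and scale 1. *)
Definition pois m z : R := z ^+ m / m`!%:R * expR (- z).

Lemma pois_ge0 m z : 0 <= z -> 0 <= pois m z.
Proof. by move=> z0; rewrite !mulr_ge0 ?exprn_ge0 ?expR_ge0// invr_ge0. Qed.

(** A single term of the exponential series is at most its sum. This bound is what puts the rescaled
    kernels in the unit interval. *)
Lemma pois_le1 m z : 0 <= z -> pois m z <= 1.
Proof.
move=> z0; rewrite /pois expRN ler_pdivrMr ?expR_gt0// mul1r.
case: m => [|m].
  by rewrite expr0 fact0 divr1; have := expR_ge1Dx z; apply: le_trans; rewrite lerDl.
by apply: le_trans (expR_ge1Dxn m z0); rewrite lerDr.
Qed.

Lemma mul_pois m z : z * pois m z = m.+1%:R * pois m.+1 z.
Proof.
rewrite /pois factS natrM exprS.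
have : (m`!%:R : R) != 0 by rewrite pnatr_eq0 -lt0n fact_gt0.
by have : (m.+1%:R : R) != 0 by []; move=> *; field; apply/andP.
Qed.

Lemma continuous_pois m : continuous (pois m : R -> R).
Proof.
move=> z; apply: cvgM.
  by apply: cvgM; [exact: exprn_continuous|exact: cvg_cst].
by apply: continuous_comp; [exact: opp_continuous|exact: continuous_expR].
Qed.

Lemma measurable_pois m : measurable_fun [set: R] (pois m).
Proof. by apply: continuous_measurable_fun; exact: continuous_pois. Qed.

(** The derivative is a difference of neighbouring weights, the weight of index -1 being 0, so
    derivatives of partial sums telescope. *)
Lemma is_derive_pois m z :
  is_derive z 1 (pois m) ((if m is k.+1 then pois k z else 0) - pois m z).
Proof.
have E : pois m = (m`!%:R^-1 : R) \*: (((id : R -> R) ^+ m) * (expR \o -%R)).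
  apply/funext => x; rewrite /pois !fctE /= /GRing.scale /=.
  by rewrite mulrA (mulrC _^-1).
rewrite E; apply: is_derive_eq.
rewrite -E /pois /= /GRing.scale /= !fctE.
case: m {E} => [|m]; first by rewrite fact0 !expr0; field.
rewrite factS natrM exprS /=.
have : (m`!%:R : R) != 0 by rewrite pnatr_eq0 -lt0n fact_gt0.
by have : (m.+1%:R : R) != 0 by []; move=> *; field; apply/andP.
Qed.

(** By [mul_pois] and [pois_le1], [z * pois m z] is at most [m + 1]. *)
Lemma pois_cvg0 m : pois m z @[z --> +oo] --> (0 : R).
Proof.
apply/cvgrPdist_le => e e0; near=> z.
have z0 : 0 < z by near: z; exact: nbhs_pinfty_gt.
rewrite sub0r normrN ger0_norm ?pois_ge0 ?(ltW z0)//.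
rewrite -(ler_pM2l z0) mul_pois (le_trans (_ : _ <= m.+1%:R)) //.
  by rewrite ler_piMr// pois_le1// ltW.
rewrite -ler_pdivrMr//; near: z; exact: nbhs_pinfty_ge.
Unshelve. all: by end_near. Qed.

(* The gamma density with shape m + 1 and scale h, on y >= 0; elsewhere it is junk. *)
Definition erlang h m y : R := pois m (y / h) / h.

Lemma erlang_ge0 h m y : 0 < h -> 0 <= y -> 0 <= erlang h m y.
Proof. by move=> h0 y0; rewrite divr_ge0 ?pois_ge0 ?divr_ge0// ltW. Qed.

Lemma mul_erlang h m y : 0 < h ->
  y * erlang h m y = h * m.+1%:R * erlang h m.+1 y.
Proof.
move=> h0; rewrite /erlang.
transitivity (y / h * pois m (y / h)); first by ring.
rewrite mul_pois; field; exact: lt0r_neq0.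
Qed.

Lemma continuous_erlang h m : continuous (erlang h m).
Proof.
move=> y; apply: cvgM; last exact: cvg_cst.
apply: (@continuous_comp _ _ _ (fun y => y / h) (pois m)); last exact: continuous_pois.
by apply: cvgM; [exact: cvg_id|exact: cvg_cst].
Qed.

Lemma measurable_erlang h m (D : set R) : measurable_fun D (erlang h m).
Proof.
by apply: measurable_funTS; apply: continuous_measurable_fun;
  exact: continuous_erlang.
Qed.

Lemma integral_erlang h m : 0 < h ->
  (\int[lebesgue_measure]_(y in `[0%R, +oo[) (erlang h m y)%:E = 1)%E.
Proof.
move=> h0.
(* Minus the Poisson distribution function: its derivative telescopes to the density, and it goes
   from -1 at 0 to 0 at infinity. *)
pose F y : R := - (\sum_(j < m.+1) pois j (y / h)).
have dF y : is_derive y 1 F (erlang h m y).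
  have dj j : is_derive y 1 (fun y => pois j (y / h))
      (((if j is k.+1 then pois k (y / h) else 0) - pois j (y / h)) / h).
    have -> : (fun y => pois j (y / h)) = pois j \o (h^-1 \*: id).
      by apply/funext => x /=; rewrite mulrC.
    have d1 : is_derive y 1 (h^-1 \*: (id : R -> R)) h^-1.
      by apply: is_derive_eq; rewrite /GRing.scale/= mulr1.
    have -> : y / h = (h^-1 \*: (id : R -> R)) y by rewrite /= mulrC.
    have := @is_derive1_comp R (pois j) (h^-1 \*: id) y _ _ (is_derive_pois j _) d1.
    by [].
  have -> : F = - \sum_(j < m.+1) (fun y => pois (j : nat) (y / h)).
    by apply/funext => x; rewrite /F opprfctE fct_sumE.
  apply: is_derive_eq.
  rewrite -big_distrl /= -mulNr; congr (_ / h).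
  rewrite -sumrN; under eq_bigr do rewrite opprB.
  rewrite big_ord_recl subr0.
  elim: m {F dj} => [|m IH]; first by rewrite big_ord0 addr0.
  by rewrite big_ord_recr /= addrA IH addrC subrK.
have F0 : F 0 = -1.
  rewrite /F big_ord_recl big1 ?addr0; last first.
    by move=> i _; rewrite /pois mul0r expr0n !mul0r.
  by rewrite /pois mul0r expr0 fact0 oppr0 expR0 divr1 mulr1.
rewrite (@ge0_continuous_FTC2y _ (erlang h m) F 0 0).
- by rewrite F0 -EFinB sub0r opprK.
- by move=> x x0; exact: erlang_ge0.
- by apply: continuous_subspaceT; exact: continuous_erlang.
- rewrite /F -[X in _ --> X]oppr0; apply: cvgN.
  have pj j : pois j (y / h) @[y --> +oo] --> (0 : R).
    apply: (@cvg_comp _ _ _ (fun y => y / h) (pois j) _ +oo); last exact: pois_cvg0.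
    by apply: gt0_cvgMly; [rewrite invr_gt0|exact: cvg_id].
  elim: m.+1 => [|k IH].
    rewrite (_ : (fun _ => _) = cst 0); first exact: cvg_cst.
    by apply/funext => y; rewrite big_ord0.
  rewrite (_ : (fun _ => _) = (fun y => \sum_(j < k) pois j (y / h) + pois k (y / h))).
    suff : \sum_(j < k) pois j (y / h) + pois k (y / h) @[y --> +oo] --> (0 + 0 : R).
      by rewrite addr0.
    exact: cvgD.
  by apply/funext => y; rewrite big_ord_recr.
- by move=> x _; case: (dF x).
- apply: cvg_at_right_filter.
  have /derivable1_diffP/differentiable_continuous : derivable F 0 1 by case: (dF 0).
  exact.
- by move=> x _; rewrite derive1E; have := dF x => ?; rewrite derive_val.
Qed.

End PoissonWeights.

(** * Bounds on the gamma function between integers *)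

Section GammaBounds.
Variable R : realType.
Implicit Types (z y h theta : R) (m : nat).

(** The tangent point [m + 1] is the one for which [z / l] times the weight of index [m] is exactly
    the weight of index [m + 1]. *)
Lemma pois_powR_le m z theta : 0 <= z -> 0 <= theta <= 1 ->
  pois m z * z `^ theta <=
  m.+1%:R `^ theta * ((1 - theta) * pois m z + theta * pois m.+1 z).
Proof.
move=> z0 t01.
have m0 : (0 : R) < m.+1%:R by [].
have -> : pois m.+1 z = z / m.+1%:R * pois m z.
  by rewrite mulrAC mul_pois mulrAC mulfV ?mul1r// gt_eqF.
have := ler_wpM2l (pois_ge0 m z0) (powR_le_tangent z0 m0 t01).
by move/le_trans; apply; rewrite le_eqVlt; apply/orP; left; apply/eqP; ring.
Qed.

Lemma pois_powR_ge m z theta : 0 <= z -> 0 <= theta ->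
  m.+1%:R `^ theta * ((1 + theta) * pois m.+1 z - theta * pois m z) <=
  pois m.+1 z * z `^ theta.
Proof.
move=> z0 t0.
have m0 : (0 : R) < m.+1%:R by [].
have -> : pois m.+1 z = z / m.+1%:R * pois m z.
  by rewrite mulrAC mul_pois mulrAC mulfV ?mul1r// gt_eqF.
have pm : 0 <= pois m z / m.+1%:R by rewrite divr_ge0 ?pois_ge0.
have := ler_wpM2l pm (powR_ge_tangent z0 m0 t0).
have -> : pois m z / m.+1%:R * (z * z `^ theta) = z / m.+1%:R * pois m z * z `^ theta by ring.
apply: le_trans; rewrite le_eqVlt; apply/orP; left; apply/eqP.
by field; rewrite addrC natr1 gt_eqF.
Qed.

Lemma integral_pois m :
  (\int[lebesgue_measure]_(y in `[0%R, +oo[) (pois m y : R)%:E = 1)%E.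
Proof.
rewrite -(@integral_erlang R 1 m ltr01); apply: eq_integral => y _.
by rewrite /erlang !divr1.
Qed.

Lemma gamma_fun_bounds m theta : 0 <= theta <= 1 ->
  m.+1`!%:R * m.+1%:R `^ theta <= gamma_fun (m.+1%:R + theta + 1)
    <= m.+1`!%:R * m.+2%:R `^ theta.
Proof.
move=> /andP[t0 t1].
have f0 : (0 : R) < m.+1`!%:R by rewrite ltr0n fact_gt0.
have mp k : measurable_fun (`[0, +oo[ : set R) (pois k : R -> R).
  by apply: measurable_funTS; exact: measurable_pois.
pose I := (\int[lebesgue_measure]_(x in `[0%R, +oo[) (pois m.+1 x * x `^ theta)%:E)%E.
have mI : measurable_fun (`[0, +oo[ : set R) (fun x : R => pois m.+1 x * x `^ theta).
  by apply: measurable_funM => //; exact: measurable_funTS (measurable_powR _).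
have pge0 k (x : R) : (`[0, +oo[%classic : set R) x -> 0 <= pois k x.
  by rewrite /= in_itv/= andbT => /(pois_ge0 k).
have Ige0 (x : R) : (`[0, +oo[%classic : set R) x -> (0 <= (pois m.+1 x * x `^ theta)%:E)%E.
  by move=> x0; rewrite lee_fin mulr_ge0 ?powR_ge0// pge0.
have scal k (c : R) : 0 <= c ->
    (\int[lebesgue_measure]_(x in `[0%R, +oo[) (c * pois k x)%:E = c%:E)%E.
  move=> c0; under eq_integral do rewrite EFinM.
  rewrite ge0_integralZl_EFin ?integral_pois ?mule1//.
    by move=> x /(pge0 k); rewrite lee_fin.
  by apply/measurable_EFinP; exact: mp.
have upper : (I <= (m.+2%:R `^ theta)%:E)%E.
  apply: (@le_trans _ _ (\int[lebesgue_measure]_(x in `[0%R, +oo[)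
     ((m.+2%:R `^ theta * (1 - theta) * pois m.+1 x)%:E
      + (m.+2%:R `^ theta * theta * pois m.+2 x)%:E))%E).
    apply: ge0_le_integral => //.
    - by apply/measurable_EFinP; exact: mI.
    - by apply: emeasurable_funD; apply/measurable_EFinP; apply: measurable_funM => //; exact: mp.
    - move=> x; rewrite /= in_itv/= andbT -EFinD lee_fin => x0.
      apply: le_trans (pois_powR_le m.+1 x0 _) _; first by rewrite t0.
      by rewrite mulrDr !mulrA.
  rewrite ge0_integralD//.
  - rewrite !scal ?mulr_ge0 ?powR_ge0 ?subr_ge0//.
    by rewrite -EFinD lee_fin -mulrDr subrK mulr1.
  - by move=> x x0; rewrite lee_fin; apply: mulr_ge0;
      [rewrite mulr_ge0 ?powR_ge0 ?subr_ge0 ?addr_ge0|exact: pge0].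
  - by apply/measurable_EFinP; apply: measurable_funM => //; exact: mp.
  - by move=> x x0; rewrite lee_fin; apply: mulr_ge0;
      [rewrite mulr_ge0 ?powR_ge0 ?subr_ge0 ?addr_ge0|exact: pge0].
  - by apply/measurable_EFinP; apply: measurable_funM => //; exact: mp.
have lower : ((m.+1%:R `^ theta)%:E <= I)%E.
  (* The negative term of the lower bound is moved to the other side, so that only nonnegative
     functions are integrated. *)
  have -> : m.+1%:R `^ theta =
     m.+1%:R `^ theta * (1 + theta) - m.+1%:R `^ theta * theta :> R by ring.
  rewrite EFinB leeBlDr//.
  rewrite -(@scal m.+1) ?mulr_ge0 ?powR_ge0 ?addr_ge0//.
  rewrite -(@scal m (_ * theta)) ?mulr_ge0 ?powR_ge0 ?addr_ge0//.
  rewrite -ge0_integralD//; last 3 first.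
  - by apply/measurable_EFinP; exact: mI.
  - by move=> x x0; rewrite lee_fin; apply: mulr_ge0;
      [rewrite mulr_ge0 ?powR_ge0 ?subr_ge0 ?addr_ge0|exact: pge0].
  - by apply/measurable_EFinP; apply: measurable_funM => //; exact: mp.
  apply: ge0_le_integral => //.
  - by move=> x x0; rewrite lee_fin; apply: mulr_ge0;
      [rewrite mulr_ge0 ?powR_ge0 ?subr_ge0 ?addr_ge0|exact: pge0].
  - by apply/measurable_EFinP; apply: measurable_funM => //; exact: mp.
  - apply: emeasurable_funD; first by apply/measurable_EFinP; exact: mI.
    by apply/measurable_EFinP; apply: measurable_funM => //; exact: mp.
  - move=> x; rewrite /= in_itv/= andbT -EFinD lee_fin => x0.
    have := pois_powR_ge m x0 t0; lra.
have gE : gamma_fun (m.+1%:R + theta + 1) = m.+1`!%:R * fine I.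
  rewrite /gamma_fun /Rintegral integral_itv_obnd_cbnd; last first.
    apply/measurable_EFinP; apply: measurable_funTS; apply: measurable_funM.
      exact: measurable_powR.
    apply: measurableT_comp => //; exact: measurable_oppr.
  have -> : (\int[lebesgue_measure]_(x in `[0%R, +oo[)
      (x `^ (m.+1%:R + theta + 1 - 1) * expR (- x))%:E = (m.+1`!%:R)%:E * I)%E.
    rewrite -ge0_integralZl_EFin//.
      apply: eq_integral => x; rewrite inE/= in_itv/= andbT => x0.
      rewrite -EFinM; congr EFin; rewrite addrK powRD.
        by rewrite powR_mulrn// /pois; field; rewrite gt_eqF.
      apply/implyP => /eqP e.
      by have : 0 < m.+1%:R + theta by [rewrite ltr_pwDl]; rewrite e ltxx.
    by apply/measurable_EFinP; exact: mI.
  by rewrite fineM// fin_numElt (lt_le_trans _ lower) ?(le_lt_trans upper) ?ltry ?ltNyr.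
have If : I \is a fin_num.
  by rewrite fin_numElt (lt_le_trans _ lower) ?(le_lt_trans upper) ?ltry ?ltNyr.
by rewrite gE !ler_pM2l// -!lee_fin fineK// lower upper.
Qed.

End GammaBounds.

(** * Comparison of arbitrary shapes with integer shapes *)

Section GammaErlang.
Variable R : realType.
Implicit Types (z y h theta : R) (m : nat).

Lemma gamma_pdf_pois m theta h y : 0 < h -> 0 <= y -> 0 <= theta <= 1 ->
  gamma_pdf (m.+1%:R + theta + 1) h y =
  m.+1`!%:R / gamma_fun (m.+1%:R + theta + 1) *
  (pois m.+1 (y / h) * (y / h) `^ theta / h).
Proof.
move=> h0 y0 t01; have /andP[t0 t1] := t01.
have f0 : (0 : R) < m.+1`!%:R by rewrite ltr0n fact_gt0.
have m0 : (0 : R) < m.+1%:R `^ theta by rewrite powR_gt0.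
have /andP[G1 _] := gamma_fun_bounds m t01.
have G0 := lt_le_trans (mulr_gt0 f0 m0) G1.
rewrite /gamma_pdf indicE mem_set/= ?in_itv/= ?y0// mulr1 addrK.
set z := y / h.
have z0 : 0 <= z by rewrite divr_ge0// ltW.
have mt : 0 < m.+1%:R + theta by rewrite ltr_pwDl.
have -> : y = h * z by rewrite /z mulrC divfK// gt_eqF.
rewrite powRM ?(ltW h0)// (@powRD _ h) ?powRr1 ?(ltW h0)//; last first.
  by rewrite (gt_eqF h0) implybT.
rewrite (@powRD _ z) ?powR_mulrn//; last by rewrite gt_eqF.
have hp : 0 < h `^ (m.+1%:R + theta) by rewrite powR_gt0.
rewrite /pois (_ : - (h * z) / h = - z); last by field; rewrite gt_eqF.
by field; rewrite !gt_eqF.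
Qed.

(** [A] and [B] are the prefactors of the two power bounds divided by the gamma value. By
    [gamma_fun_bounds] both differ from 1 by at most the relative gap between the powers of [m + 2]
    and [m + 1], which is controlled by [1 / (m + 1)]. *)
Lemma gamma_pdf_sandwich m theta h : 0 < h -> 0 <= theta <= 1 ->
  exists A B : R, [/\ 0 <= A <= 1 + m.+1%:R^-1, 1 - m.+1%:R^-1 <= B <= 1,
    forall y, 0 <= y -> gamma_pdf (m.+1%:R + theta + 1) h y <=
      A * ((1 - theta) * erlang h m.+1 y + theta * erlang h m.+2 y)
  & forall y, 0 <= y ->
      B * ((1 + theta) * erlang h m.+1 y - theta * erlang h m y) <=
      gamma_pdf (m.+1%:R + theta + 1) h y].
Proof.
move=> h0 t01; have /andP[t0 t1] := t01.
have f0 : (0 : R) < m.+1`!%:R by rewrite ltr0n fact_gt0.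
have m1 : (0 : R) < m.+1%:R `^ theta by rewrite powR_gt0.
have m2 : (0 : R) < m.+2%:R `^ theta by rewrite powR_gt0.
have /andP[G1 G2] := gamma_fun_bounds m t01.
have G0 := lt_le_trans (mulr_gt0 f0 m1) G1.
set G := gamma_fun _ in G0 G1 G2 *.
have ratio : m.+2%:R `^ theta <= (1 + m.+1%:R^-1) * m.+1%:R `^ theta :> R.
  have -> : m.+2%:R = (1 + m.+1%:R^-1) * m.+1%:R :> R.
    by rewrite mulrDl mul1r mulVf// natr1.
  rewrite powRM// ?addr_ge0// ?ler_wpM2r// ?powR_ge0//.
  by rewrite ler1_powR// lerDl.
exists (m.+1`!%:R * m.+2%:R `^ theta / G), (m.+1`!%:R * m.+1%:R `^ theta / G).
split.
- rewrite divr_ge0 ?mulr_ge0 ?(ltW m2) ?(ltW G0)//=.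
  rewrite ler_pdivrMr// (le_trans (ler_wpM2l (ltW f0) ratio))//.
  by rewrite mulrCA ler_wpM2l// addr_ge0.
- apply/andP; split; last by rewrite ler_pdivrMr// mul1r.
  rewrite ler_pdivlMr//.
  have [k1|k1] := leP (1 - m.+1%:R^-1 : R) 0.
    by apply: le_trans (ltW (mulr_gt0 f0 m1)); rewrite mulr_le0_ge0// ltW.
  apply: (le_trans (ler_wpM2l (ltW k1) G2)).
  rewrite mulrCA ler_wpM2l ?(ltW f0)//.
  apply: (le_trans (ler_wpM2l (ltW k1) ratio)).
  rewrite mulrA ler_piMl ?(ltW m1)//.
  have : 0 <= (m.+1%:R^-1 : R) ^+ 2 by rewrite exprn_ge0.
  by move: (m.+1%:R^-1 : R) => k ?; lra.
- move=> y y0; rewrite gamma_pdf_pois// -/G.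
  have z0 : 0 <= y / h by rewrite divr_ge0// ltW.
  have := pois_powR_le m.+1 z0 t01.
  rewrite -(ler_pM2l (divr_gt0 f0 G0)) -(ler_pM2r (_ : 0 < h^-1)) ?invr_gt0// -!mulrA.
  move/le_trans; apply; rewrite /erlang le_eqVlt; apply/orP; left; apply/eqP.
  by field; rewrite !gt_eqF.
- move=> y y0; rewrite gamma_pdf_pois// -/G.
  have z0 : 0 <= y / h by rewrite divr_ge0// ltW.
  have := pois_powR_ge m z0 t0.
  rewrite -(ler_pM2l (divr_gt0 f0 G0)) -(ler_pM2r (_ : 0 < h^-1)) ?invr_gt0// -!mulrA.
  apply: le_trans; rewrite /erlang le_eqVlt; apply/orP; left; apply/eqP.
  by field; rewrite !gt_eqF.
Qed.

(** The sandwich is averaged over the sample. The factor 3 comes from the lower combination, whose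
    coefficients [1 + theta] and [- theta] have absolute values summing to at most 3; the term
    [v / (m + 1)] pays for [A] and [B]. *)
Lemma gamma_kde_le_erlang d (T : measurableType d) (bw : nat -> R)
    (X : int -> T -> R) n w m theta v e :
  0 < bw n -> (forall t, 0 <= X t w) -> 0 <= theta <= 1 -> 0 <= v ->
  (forall j, (m <= j <= m.+2)%N ->
     `|n%:R^-1 * \sum_(1 <= t < n.+1) erlang (bw n) j (X t%:Z w) - v| <= e) ->
  `|gamma_kde bw X n w ((m.+1%:R + theta) * bw n) - v| <= v / m.+1%:R + 3 * e.
Proof.
move=> h0 X0 t01 v0 De; have /andP[t0 t1] := t01.
rewrite /gamma_kde mulfK ?gt_eqF//.
have [A [B [/andP[A0 A1] /andP[B0 B1] UA LB]]] := gamma_pdf_sandwich m h0 t01.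
pose D j : R := n%:R^-1 * \sum_(1 <= t < n.+1) erlang (bw n) j (X t%:Z w).
have e0 : 0 <= e by apply: le_trans (De m _) => //; rewrite leqnn !leqW.
have Dj j : (m <= j <= m.+2)%N -> v - e <= D j <= v + e.
  by move=> /De; rewrite ler_distl.
have /andP[Da Db] : v - e <= D m <= v + e by apply: Dj; rewrite leqnn !leqW.
have /andP[Dc Dd] : v - e <= D m.+1 <= v + e by apply: Dj; rewrite !leqnSn.
have /andP[De' Df] : v - e <= D m.+2 <= v + e by apply: Dj; rewrite leqnn !leqW.
set D0 := n%:R^-1 * _.
have U : D0 <= A * ((1 - theta) * D m.+1 + theta * D m.+2).
  rewrite /D0 /D.
  rewrite (_ : A * _ = n%:R^-1 * \sum_(1 <= t < n.+1)
     A * ((1 - theta) * erlang (bw n) m.+1 (X t%:Z w) +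
          theta * erlang (bw n) m.+2 (X t%:Z w))); last first.
    by rewrite -big_distrr big_split -!big_distrr/=; ring.
  by rewrite ler_wpM2l ?invr_ge0// ler_sum// => t _; exact: UA.
have L : B * ((1 + theta) * D m.+1 - theta * D m) <= D0.
  rewrite /D0 /D.
  rewrite (_ : B * _ = n%:R^-1 * \sum_(1 <= t < n.+1)
     B * ((1 + theta) * erlang (bw n) m.+1 (X t%:Z w) -
          theta * erlang (bw n) m (X t%:Z w))); last first.
    by rewrite -big_distrr sumrB -!big_distrr/=; ring.
  by rewrite ler_wpM2l ?invr_ge0// ler_sum// => t _; exact: LB.
set k : R := m.+1%:R^-1 in A1 B0 *.
have k0 : 0 <= k by rewrite invr_ge0.
have k1 : k <= 1 by rewrite invf_le1// ler1n.
have U2 : (1 - theta) * D m.+1 + theta * D m.+2 <= v + e.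
  have P1 : (1 - theta) * D m.+1 <= (1 - theta) * (v + e).
    by rewrite ler_wpM2l// subr_ge0.
  have P2 : theta * D m.+2 <= theta * (v + e) by rewrite ler_wpM2l.
  lra.
have L2 : v - 3 * e <= (1 + theta) * D m.+1 - theta * D m.
  have P1 : (1 + theta) * (v - e) <= (1 + theta) * D m.+1.
    by rewrite ler_wpM2l// addr_ge0.
  have P2 : theta * D m <= theta * (v + e) by rewrite ler_wpM2l.
  have P3 : theta * e <= 1 * e by rewrite ler_wpM2r.
  lra.
have U3 : A * ((1 - theta) * D m.+1 + theta * D m.+2) <= (1 + k) * (v + e).
  apply: (le_trans (ler_wpM2l A0 U2)).
  by rewrite ler_wpM2r// addr_ge0.
have ke : k * e <= 1 * e by rewrite ler_wpM2r.
have B00 : 0 <= B by lra.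
have L3 := le_trans (ler_wpM2l B00 L2) L.
have Be : B * e <= 1 * e by rewrite ler_wpM2r.
have Bv : (1 - k) * v <= B * v by rewrite ler_wpM2r.
rewrite ler_norml; apply/andP; split; lra.
Qed.

End GammaErlang.

(** * Conditional densities *)

Section MonotoneClass.
Import HBNNSimple.

(** A nonnegative measurable function is an increasing limit of simple functions. The linear step
    has the form [c * f + g] so that a simple function can be built one level set at a time. *)
Lemma ge0_measurable_fun_ind d (T : measurableType d) (R : realType)
    (Q : (T -> \bar R) -> Prop) :
  (forall A, measurable A -> Q (fun x => (\1_A x)%:E)) ->
  (forall (c : R) f g, 0 <= c ->
     measurable_fun setT f -> (forall x, 0 <= f x)%E ->
     measurable_fun setT g -> (forall x, 0 <= g x)%E ->
     Q f -> Q g -> Q (fun x => c%:E * f x + g x)%E) ->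
  (forall (u : nat -> T -> \bar R) f,
     (forall n, measurable_fun setT (u n)) -> (forall n x, 0 <= u n x)%E ->
     (forall x, nondecreasing_seq (u ^~ x)) ->
     (forall x, u ^~ x @ \oo --> f x) ->
     (forall n, Q (u n)) -> Q f) ->
  forall f, measurable_fun setT f -> (forall x, 0 <= f x)%E -> Q f.
Proof.
move=> Qind Qlin Qlim f mf f0.
pose u_ := nnsfun_approx measurableT mf.
apply: (Qlim (fun n x => (u_ n x)%:E) f).
- by move=> n; exact/measurable_EFinP.
- by move=> n x; rewrite lee_fin.
- by move=> x m n mn; rewrite lee_fin; exact/lefP/nd_nnsfun_approx.
- by move=> x; exact: cvg_nnsfun_approx.
move=> n; set s := u_ n.
have -> : (fun x => (s x)%:E) = (fun x => (\sum_(y <- fset_set (range s))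
    (y * \1_(s @^-1` [set y]) x)%:E)%E).
  by apply/funext => x /=; rewrite fimfunE -fsumEFin// fsbig_finite.
have rs y : y \in enum_fset (fset_set (range s)) -> 0 <= y.
  by rewrite -[_ \in _]/(y \in fset_set (range s)) in_fset_set// => /set_mem[x _ <-].
have ms y : measurable (s @^-1` [set y]).
  by rewrite -[_ @^-1` _]setTI; exact: measurable_funP.
elim: (enum_fset _) rs => [|y l IH] rs.
  (* The zero function, which starts the induction, is obtained as the indicator of the empty
     set. *)
  have -> : (fun x : T => (\sum_(y <- [::]) (y * \1_(s @^-1` [set y]) x)%:E)%E) =
      (fun x => (\1_set0 x)%:E).
    by apply/funext => x; rewrite big_nil indic0.
  exact: Qind.
have -> : (fun x : T => (\sum_(y <- y :: l) (y * \1_(s @^-1` [set y]) x)%:E)%E) =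
   (fun x => (y%:E * (\1_(s @^-1` [set y]) x)%:E +
      \sum_(y <- l) (y * \1_(s @^-1` [set y]) x)%:E)%E).
  by apply/funext => x; rewrite big_cons EFinM.
have rl z : z \in l -> 0 <= z by move=> zl; apply: rs; rewrite in_cons zl orbT.
apply: Qlin.
- by apply: rs; rewrite in_cons eqxx.
- by apply/measurable_EFinP; exact: measurable_indic.
- by move=> x; rewrite lee_fin.
- apply: emeasurable_sum => z; apply/measurable_EFinP; apply: measurable_funM => //.
- by move=> x; rewrite big_seq sume_ge0// => z /rl z0; rewrite lee_fin mulr_ge0.
- exact: Qind.
- exact: IH.
Qed.

End MonotoneClass.

Section WeightedIntegrals.
Context d (T : measurableType d) (R : realType).
Variable mu : {measure set T -> \bar R}.
Variable F : T -> R.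
Hypotheses (mF : measurable_fun setT F) (F0 : forall x, 0 <= F x).

Lemma integral_weight_linear (c : R) (p q : T -> \bar R) : 0 <= c ->
  measurable_fun setT p -> (forall x, 0 <= p x)%E ->
  measurable_fun setT q -> (forall x, 0 <= q x)%E ->
  (\int[mu]_x ((c%:E * p x + q x) * (F x)%:E) =
   c%:E * \int[mu]_x (p x * (F x)%:E) + \int[mu]_x (q x * (F x)%:E))%E.
Proof.
move=> c0 mp p0 mq q0.
have mFE : measurable_fun setT (fun x => (F x)%:E) by exact/measurable_EFinP.
have F0E x : (0 <= (F x)%:E)%E by rewrite lee_fin.
have mpF : measurable_fun setT (fun x => p x * (F x)%:E)%E.
  exact: emeasurable_funM.
have mqF : measurable_fun setT (fun x => q x * (F x)%:E)%E.
  exact: emeasurable_funM.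
under eq_integral do rewrite ge0_muleDl ?mule_ge0// -muleA.
rewrite ge0_integralD//.
- by rewrite ge0_integralZl_EFin// => x _; rewrite mule_ge0.
- by move=> x _; rewrite !mule_ge0.
- exact: measurable_funeM.
- by move=> x _; rewrite mule_ge0.
Qed.

Lemma integral_weight_cvg (u : nat -> T -> \bar R) (p : T -> \bar R) :
  (forall n, measurable_fun setT (u n)) -> (forall n x, 0 <= u n x)%E ->
  (forall x, nondecreasing_seq (u ^~ x)) -> (forall x, u ^~ x @ \oo --> p x) ->
  (\int[mu]_x (u n x * (F x)%:E) @[n --> \oo] --> \int[mu]_x (p x * (F x)%:E))%E.
Proof.
move=> mu_ u0 ndu up.
have F0E x : (0 <= (F x)%:E)%E by rewrite lee_fin.
have -> : (\int[mu]_x (p x * (F x)%:E) =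
    \int[mu]_x limn (fun n => u n x * (F x)%:E))%E.
  by apply: eq_integral => x _; apply/esym/cvg_lim => //; exact: cvgeZr.
apply: cvg_monotone_convergence => //.
- by move=> n; apply: emeasurable_funM => //; exact/measurable_EFinP.
- by move=> n x _; rewrite mule_ge0.
- by move=> x _ m n mn; rewrite lee_wpmul2r// ndu.
Qed.

End WeightedIntegrals.

(** * Integration against a conditional density *)

Section ConditionalIntegral.
Context d (T : measurableType d) (R : realType) (P : probability T R).
Variable gen : set (set T).
Hypothesis gen_meas : <<s gen >> `<=` measurable.

Lemma measurable_fun_sub_sigma d' (E : measurableType d')
    (F : T -> E) :
  measurable_fun [set: g_sigma_algebraType gen] (F : g_sigma_algebraType gen -> E) ->
  measurable_fun [set: T] F.
Proof. by move=> mF _ B mB; apply: gen_meas; exact: mF. Qed.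

(** Taking out what is known: equality on the events of the sub-sigma-algebra is the case of
    indicator weights, and induction on [W] does the rest. *)
Lemma ge0_integral_weighted (F1 F2 : T -> R) (W : T -> \bar R) :
  measurable_fun setT F1 -> (forall w, 0 <= F1 w) ->
  measurable_fun setT F2 -> (forall w, 0 <= F2 w) ->
  (forall C, <<s gen >> C ->
     \int[P]_(w in C) (F1 w)%:E = \int[P]_(w in C) (F2 w)%:E)%E ->
  measurable_fun [set: g_sigma_algebraType gen] (W : g_sigma_algebraType gen -> _) ->
  (forall w, 0 <= W w)%E ->
  (\int[P]_w (W w * (F1 w)%:E) = \int[P]_w (W w * (F2 w)%:E))%E.
Proof.
move=> mF1 F10 mF2 F20 eqF mW W0.
move: W mW W0.
apply: (@ge0_measurable_fun_ind _ (g_sigma_algebraType gen) R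
  (fun W => \int[P]_w (W w * (F1 w)%:E) = \int[P]_w (W w * (F2 w)%:E))%E).
- move=> C mC.
  have K F : (\int[P]_w ((\1_C w)%:E * F w) = \int[P]_(w in C) F w)%E.
    rewrite [RHS]integral_mkcond; apply: eq_integral => w _.
    by rewrite epatch_indic muleC.
  by rewrite !K eqF.
- move=> c p q c0 /measurable_fun_sub_sigma mp p0.
  move=> /measurable_fun_sub_sigma mq q0 Qp Qq.
  by rewrite !integral_weight_linear// Qp Qq.
- move=> u p mu u0 ndu up Qu.
  have mu' n := measurable_fun_sub_sigma (mu n).
  have L1 := integral_weight_cvg (mu := P) mF1 F10 mu' u0 ndu up.
  have L2 := integral_weight_cvg (mu := P) mF2 F20 mu' u0 ndu up.
  have E : (fun n => \int[P]_w (u n w * (F1 w)%:E))%E =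
      (fun n => \int[P]_w (u n w * (F2 w)%:E))%E by apply/funext => n; exact: Qu.
  rewrite -(cvg_lim (@ereal_hausdorff R) L1) -(cvg_lim (@ereal_hausdorff R) L2).
  by congr (limn _); exact: E.
Qed.

Variables (X : T -> R) (g : T -> R -> R).
Hypothesis mX : measurable_fun setT X.
Hypothesis gX : is_cond_density P <<s gen >> X g.

(** The definition of a conditional density is the case of indicators. Measurability in [w] is
    carried through the same induction, because [g] is given as measurable only in its second
    argument. *)
Lemma cond_density_integral (p : R -> \bar R) :
  measurable_fun setT p -> (forall y, 0 <= p y)%E ->
  measurable_fun [set: g_sigma_algebraType gen]
    ((fun w => \int[lebesgue_measure]_y (p y * (g w y)%:E))%E :
      g_sigma_algebraType gen -> _) /\
  forall C, <<s gen >> C ->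
    (\int[P]_(w in C) \int[lebesgue_measure]_y (p y * (g w y)%:E)
     = \int[P]_(w in C) p (X w))%E.
Proof.
have [mg g0 gE] := gX.
pose J (p : R -> \bar R) w := (\int[lebesgue_measure]_y (p y * (g w y)%:E))%E.
rewrite -/(J p).
move: p; apply: (@ge0_measurable_fun_ind _ R R (fun p =>
  measurable_fun [set: g_sigma_algebraType gen] (J p : g_sigma_algebraType gen -> _) /\
  forall C, <<s gen >> C -> (\int[P]_(w in C) J p w = \int[P]_(w in C) p (X w))%E)).
- move=> A mA; have [_ mZ ZE] := gE A mA.
  have -> : J (fun y => (\1_A y)%:E) =
      (fun w => \int[lebesgue_measure]_(y in A) (g w y)%:E)%E.
    apply/funext => w; rewrite /J [RHS]integral_mkcond; apply: eq_integral => y _.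
    by rewrite epatch_indic muleC.
  split; first by move=> _ B mB; rewrite setTI; exact: mZ.
  by move=> C GC; rewrite ZE.
- move=> c p q c0 mp p0 mq q0 [mIp Ip] [mIq Iq].
  have -> : J (fun y => c%:E * p y + q y)%E = (fun w => c%:E * J p w + J q w)%E.
    by apply/funext => w; exact: (integral_weight_linear lebesgue_measure
      (mg w) (g0 w) c0 mp p0 mq q0).
  have J0 r w : (forall y, 0 <= r y)%E -> (0 <= J r w)%E.
    by move=> r0; apply: integral_ge0 => y _; rewrite mule_ge0// lee_fin.
  split; first by apply: emeasurable_funD => //; exact: measurable_funeM.
  move=> C GC; have mC := gen_meas GC.
  have mp' := measurable_funTS (measurable_fun_sub_sigma mIp).
  have mq' := measurable_funTS (measurable_fun_sub_sigma mIq).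
  have mpX : measurable_fun C (p \o X).
    by apply: measurable_funTS; exact: measurableT_comp.
  have mqX : measurable_fun C (q \o X).
    by apply: measurable_funTS; exact: measurableT_comp.
  rewrite ge0_integralD//.
  + rewrite ge0_integralZl_EFin ?Ip ?Iq//.
      rewrite [RHS]ge0_integralD//.
      * by rewrite ge0_integralZl_EFin.
      * by move=> w _; rewrite mule_ge0.
      * exact: measurable_funeM.
    by move=> w _; exact: J0.
  + by move=> w _; rewrite mule_ge0// J0.
  + exact: measurable_funeM.
  + by move=> w _; exact: J0.
- move=> u p mu u0 ndu up Qu.
  (* Monotone convergence is used twice on this side: in [y] for each fixed [w], then in [w]. *)
  have K w : J (u n) w @[n --> \oo] --> J p w.
    exact: (integral_weight_cvg (mu := lebesgue_measure) (mg w) (g0 w) mu u0 ndu up).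
  split.
    apply: (emeasurable_fun_cvg (fun n => J (u n) : g_sigma_algebraType gen -> _)).
      by move=> n; case: (Qu n).
    by move=> w _; exact: K.
  move=> C GC; have mC := gen_meas GC.
  have J0 n w : (0 <= J (u n) w)%E.
    by apply: integral_ge0 => y _; rewrite mule_ge0// lee_fin.
  have L1 : (\int[P]_(w in C) J (u n) w @[n --> \oo] --> \int[P]_(w in C) J p w)%E.
    have -> : (\int[P]_(w in C) J p w = \int[P]_(w in C) limn (fun n => J (u n) w))%E.
      by apply: eq_integral => w _; apply/esym/cvg_lim => //; exact: K.
    apply: cvg_monotone_convergence => //.
    + move=> n; apply: measurable_funTS.
      by have [/measurable_fun_sub_sigma] := Qu n.
    + move=> w _ m n mn; apply: ge0_le_integral => //.
      * by move=> y _; rewrite mule_ge0// lee_fin.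
      * by apply: emeasurable_funM; [exact: mu|apply/measurable_EFinP; exact: mg].
      * by apply: emeasurable_funM; [exact: mu|apply/measurable_EFinP; exact: mg].
      * by move=> y _; rewrite lee_wpmul2r ?lee_fin// ndu.
  have L2 : (\int[P]_(w in C) u n (X w) @[n --> \oo] --> \int[P]_(w in C) p (X w))%E.
    have -> : (\int[P]_(w in C) p (X w) = \int[P]_(w in C) limn (fun n => u n (X w)))%E.
      by apply: eq_integral => w _; apply/esym/cvg_lim => //; exact: up.
    apply: cvg_monotone_convergence => //.
    + by move=> n; apply: measurable_funTS; exact: measurableT_comp.
  have E : (fun n => \int[P]_(w in C) J (u n) w)%E =
      (fun n => \int[P]_(w in C) u n (X w))%E.
    by apply/funext => n; exact: (Qu n).2 GC.
  rewrite -(cvg_lim (@ereal_hausdorff R) L1) -(cvg_lim (@ereal_hausdorff R) L2).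
  by congr (limn _); exact: E.
Qed.

End ConditionalIntegral.

(** * Multiplicative Chernoff bound *)

(** With [u = l * k], [expR u] is at most [1 / (1 - u)], hence at most [1 + u + 2 u^2]. Then
    [k^2 <= k] makes the bound affine in [k], so that conditional expectations pass through it. *)
Lemma expR_mul_le_affine (R : realType) (l k : R) : `|l| <= 1/2 -> 0 <= k <= 1 ->
  expR (l * k) <= 1 + (l + 2 * l ^+ 2) * k.
Proof.
move=> l2 /andP[k0 k1].
have [la lb] : - (1/2) <= l /\ l <= 1/2 by apply/andP; rewrite -ler_norml.
set u := l * k.
have u2 : `|u| <= 1/2 by rewrite normrM (ger0_norm k0) -[leRHS]mulr1 ler_pM.
have [ua ub] : - (1/2) <= u /\ u <= 1/2 by apply/andP; rewrite -ler_norml.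
have u1 : 0 < 1 - u by lra.
have H : expR u <= (1 - u)^-1.
  rewrite -[leLHS]invrK lef_pV2 ?posrE ?invr_gt0 ?expR_gt0// -expRN.
  exact: expR_ge1Dx.
apply: (le_trans H).
apply: (@le_trans _ _ (1 + u + 2 * u ^+ 2)).
  rewrite -[leLHS]mul1r ler_pdivrMr//.
  have := sqr_ge0 u => q.
  (* This is the excess over 1 of [(1 - u) * (1 + u + 2 u^2)]. *)
  have : 0 <= u ^+ 2 * (1 - 2 * u) by rewrite mulr_ge0//; lra.
  move=> q2; lra.
have k2 : k ^+ 2 <= k by rewrite expr2 ler_piMr.
have : 2 * l ^+ 2 * k ^+ 2 <= 2 * l ^+ 2 * k.
  by rewrite ler_wpM2l// mulr_ge0// sqr_ge0.
by rewrite /u; lra.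
Qed.

Section Chernoff.
Context d (T : measurableType d) (R : realType) (P : probability T R).
Variable gen : nat -> set (set T).
Hypothesis gen_meas : forall t, <<s gen t >> `<=` measurable.
Hypothesis gen_mono : forall s t, (s <= t)%N -> <<s gen s >> `<=` <<s gen t >>.
Variables kap mu : nat -> T -> R.
Hypothesis kap01 : forall t w, 0 <= kap t w <= 1.
Hypothesis mu01 : forall t w, 0 <= mu t w <= 1.
Hypothesis mkap : forall t, measurable_fun [set: g_sigma_algebraType (gen t.+1)]
  (kap t : g_sigma_algebraType (gen t.+1) -> R).
Hypothesis mmu : forall t, measurable_fun [set: g_sigma_algebraType (gen t)]
  (mu t : g_sigma_algebraType (gen t) -> R).
Hypothesis kapE : forall t C, <<s gen t >> C ->
  (\int[P]_(w in C) (kap t w)%:E = \int[P]_(w in C) (mu t w)%:E)%E.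

Let S n w := \sum_(t < n) kap t w.
Let M n w := \sum_(t < n) mu t w.
(** The exponential supermartingale. The quadratic correction is charged to [M], not to [n], which
    makes the resulting deviation bound relative to the mean. *)
Let W (l : R) n w := expR (l * S n w - (l + 2 * l ^+ 2) * M n w).

Let msub t (F : T -> R) :
  measurable_fun [set: g_sigma_algebraType (gen t)]
    (F : g_sigma_algebraType (gen t) -> R) ->
  measurable_fun [set: T] F.
Proof. exact: (measurable_fun_sub_sigma (@gen_meas t)). Qed.

Let mkapT t : measurable_fun [set: T] (kap t).
Proof. exact: (msub (@mkap t)). Qed.

Let mmuT t : measurable_fun [set: T] (mu t).
Proof. exact: (msub (@mmu t)). Qed.

Let mS n : measurable_fun [set: g_sigma_algebraType (gen n)]
  (S n : g_sigma_algebraType (gen n) -> R).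
Proof.
apply: measurable_sum => t.
by move=> _ B mB; apply: (@gen_mono t.+1) => //; exact: mkap.
Qed.

Let mM n : measurable_fun [set: g_sigma_algebraType (gen n)]
  (M n : g_sigma_algebraType (gen n) -> R).
Proof.
apply: measurable_sum => t.
by move=> _ B mB; apply: (@gen_mono t) => //; [exact: ltnW|exact: mmu].
Qed.

Let mW l n : measurable_fun [set: g_sigma_algebraType (gen n)]
  (W l n : g_sigma_algebraType (gen n) -> R).
Proof.
apply: measurableT_comp => //.
by apply: measurable_funB; apply: measurable_funM.
Qed.

(** One step: bound the new exponential factor by an affine function of [kap n], replace [kap n] by
    [mu n] under the integral, and bound [1 + c * mu n] by its exponential, which the compensator
    cancels. *)
Lemma expectation_exp_le1 (l : R) n : `|l| <= 1/2 ->
  (\int[P]_w (W l n w)%:E <= 1)%E.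
Proof.
move=> l2; elim: n => [|n IH].
  under eq_integral do rewrite /W /S /M !big_ord0 !mulr0 subr0 expR0.
  by rewrite integral_cst// mul1e; exact: probability_le1.
set c := l + 2 * l ^+ 2.
have [la lb] : - (1/2) <= l /\ l <= 1/2 by apply/andP; rewrite -ler_norml.
(* This keeps [1 + c * k] nonnegative for [k] in the unit interval. *)
have c1 : -1 <= c by have := sqr_ge0 l; rewrite /c => ?; lra.
have aff (k : R) : 0 <= k <= 1 -> 0 <= 1 + c * k.
  move=> /andP[k0 k1]; have : -1 * k <= c * k by rewrite ler_wpM2r.
  lra.
(* The factor of [W l n.+1] already determined at time [n]; it serves as the weight in
   [ge0_integral_weighted]. *)
pose V w := W l n w * expR (- (c * mu n w)).
have V0 w : 0 <= V w by rewrite mulr_ge0 ?expR_ge0.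
have mV : measurable_fun [set: g_sigma_algebraType (gen n)]
   (V : g_sigma_algebraType (gen n) -> R).
  apply: measurable_funM => //; apply: measurableT_comp => //.
  by apply: measurableT_comp => //; apply: measurable_funM.
have mWT k : measurable_fun [set: T] (W l k).
  exact: (msub (@mW l k)).
have mVT : measurable_fun [set: T] V.
  exact: (msub mV).
have maff (k : T -> R) : measurable_fun [set: T] k ->
    measurable_fun [set: T] (fun w => 1 + c * k w).
  by move=> mk; apply: measurable_funD => //; apply: measurable_funM.
have E C : <<s gen n >> C ->
  (\int[P]_(w in C) (1 + c * kap n w)%:E = \int[P]_(w in C) (1 + c * mu n w)%:E)%E.
  move=> GC; have mC := gen_meas GC.
  have K (k : T -> R) : measurable_fun [set: T] k -> (forall w, 0 <= k w <= 1) ->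
     (\int[P]_(w in C) (1 + c * k w)%:E = \int[P]_(w in C) (1%:E) +
        c%:E * \int[P]_(w in C) (k w)%:E)%E.
    move=> mk k01.
    have ik : P.-integrable C (EFin \o k).
      apply: (@measurable_bounded_integrable _ _ _ P) => //.
      - by rewrite (le_lt_trans (probability_le1 P mC))// ltry.
      - exact: measurable_funTS.
      - exists 1; split; first exact: num_real.
        move=> x x1 w _ /=; rewrite ger0_norm; last by case/andP: (k01 w).
        by apply: ltW; apply: le_lt_trans x1; case/andP: (k01 w).
    under eq_integral do rewrite EFinD EFinM.
    rewrite integralD//.
    - by rewrite integralZl.
    - apply: finite_measure_integrable_cst => //.
    - exact: integrableZl.
  by rewrite !K// kapE.
apply: (@le_trans _ _ (\int[P]_w ((V w)%:E * (1 + c * kap n w)%:E))%E).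
  apply: ge0_le_integral => //.
  - by move=> w _; rewrite lee_fin expR_ge0.
  - exact/measurable_EFinP.
  - by apply: emeasurable_funM; apply/measurable_EFinP => //; exact: maff.
  - move=> w _; rewrite -EFinM lee_fin.
    have -> : W l n.+1 w = V w * expR (l * kap n w).
      rewrite /V /W -!expRD; congr expR.
      by rewrite /S /M !big_ord_recr /= /c; ring.
    by rewrite ler_wpM2l//; exact: expR_mul_le_affine.
rewrite (ge0_integral_weighted (gen_meas (t := n)) (F2 := fun w => 1 + c * mu n w))//.
- apply: le_trans IH; apply: ge0_le_integral => //.
  - by move=> w _; rewrite -EFinM lee_fin mulr_ge0 ?aff.
  - by apply: emeasurable_funM; apply/measurable_EFinP => //; exact: maff.
  - exact/measurable_EFinP.
  - move=> w _; rewrite -EFinM lee_fin.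
    have -> : W l n w = V w * expR (c * mu n w).
      by rewrite /V -mulrA -expRD addNr expR0 mulr1.
    by rewrite ler_wpM2l//; exact: expR_ge1Dx.
- exact: maff.
- by move=> w; exact: aff.
- exact: maff.
- by move=> w; exact: aff.
- exact/measurable_EFinP.
Qed.

(** Markov's inequality applied to [W l n]. *)
Lemma exp_tail (l : R) n (s : R) : `|l| <= 1/2 ->
  (P [set w | (s <= l * S n w - (l + 2 * l ^+ 2) * M n w)%R] <= (expR (- s))%:E)%E.
Proof.
move=> l2; have Wle := expectation_exp_le1 n l2.
have mWT : measurable_fun [set: T] (W l n) by exact: (msub (@mW l n)).
set A := [set w | _].
have AE : A = [set w | expR s <= W l n w].
  by apply/seteqP; split=> w; rewrite /A /W /= ler_expR.
have mA : measurable A.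
  rewrite AE -[X in measurable X]setTI.
  have -> : [set w | expR s <= W l n w] = W l n @^-1` `[expR s, +oo[.
    by apply/seteqP; split => w; rewrite /= in_itv/= andbT.
  exact: mWT.
have : ((expR s)%:E * P A <= 1)%E.
  apply: le_trans Wle.
  rewrite -[in leLHS](setIT A) -integral_indic// -ge0_integralZl_EFin//; last first.
    exact/measurable_EFinP.
  apply: ge0_le_integral => //.
  - by apply: measurable_funeM; exact/measurable_EFinP.
  - exact/measurable_EFinP.
  - move=> w _; rewrite -EFinM lee_fin indicE; case: (boolP (w \in A)) => wA.
      by rewrite mulr1; move: wA; rewrite AE inE.
    by rewrite mulr0 expR_ge0.
by rewrite expRN -[(_^-1)%:E]mul1e lee_pdivlMr ?expR_gt0// muleC.
Qed.

(** The two signs of the deviation are covered by [exp_tail] with [l = eta] and [l = - eta], at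
    level [eta^2 * a]: the deviation inequality is simply multiplied by [eta]. *)
Lemma martingale_chernoff (eta : R) n (a : R) : 0 < eta <= 1/2 ->
  (P [set w | (2 * eta * M n w + eta * a < `|S n w - M n w|)%R]
   <= (2 * expR (- (eta ^+ 2 * a)))%:E)%E.
Proof.
move=> /andP[e0 e2].
pose A l := [set w | eta ^+ 2 * a <= l * S n w - (l + 2 * l ^+ 2) * M n w].
have mA l : measurable (A l).
  rewrite -[X in measurable X]setTI.
  have -> : A l = (fun w => l * S n w - (l + 2 * l ^+ 2) * M n w) @^-1` `[eta ^+ 2 * a, +oo[.
    by apply/seteqP; split => w; rewrite /= in_itv/= andbT.
  have mSl := msub (@mS n).
  have mMl := msub (@mM n).
  have mf : measurable_fun [set: T] (fun w => l * S n w - (l + 2 * l ^+ 2) * M n w).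
    by apply: measurable_funB; apply: measurable_funM.
  exact: mf.
have sub : [set w | 2 * eta * M n w + eta * a < `|S n w - M n w|] `<=` A eta `|` A (- eta).
  move=> w /=; case: (lerP 0 (S n w - M n w)) => h0.
    rewrite ger0_norm// => /(ltW) h; left.
    have := ler_wpM2l (ltW e0) h; rewrite /A /=; lra.
  rewrite ltr0_norm// => /(ltW) h; right.
  have := ler_wpM2l (ltW e0) h; rewrite /A /=; lra.
apply: (@le_trans _ _ (P (A eta) + P (A (- eta)%R))%E).
  apply: (@le_trans _ _ (P (A eta `|` A (- eta)))); last exact: measureU2.
  apply: le_measure => //; rewrite inE; last exact: measurableU.
  have mSl := msub (@mS n).
  have mMl := msub (@mM n).
  rewrite -[X in measurable X]setTI.
  have -> : [set w | 2 * eta * M n w + eta * a < `|S n w - M n w|] =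
    (fun w => `|S n w - M n w| - (2 * eta * M n w + eta * a)) @^-1` `]0, +oo[.
    by apply/seteqP; split => w; rewrite /= in_itv/= andbT subr_gt0.
  have mf : measurable_fun [set: T] (fun w => `|S n w - M n w| - (2 * eta * M n w + eta * a)).
    apply: measurable_funB.
      by apply: measurableT_comp => //; apply: measurable_funB.
    by apply: measurable_funD => //; apply: measurable_funM.
  exact: mf.
rewrite mulr_natl mulr2n EFinD.
by apply: leeD; apply: exp_tail; rewrite ?normrN gtr0_norm.
Qed.

End Chernoff.

(** * Approximation of the identity *)

Lemma C0_bounded (R : realType) (f : R -> R) : C0 f ->
  exists M : R, forall x, `|f x| <= M.
Proof.
move=> [cf fpoo fnoo].
have [A [_ HA]] : \forall x \near +oo, `|f x| <= 1.
  by move/cvgr0Pnorm_le : fpoo; apply.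
have [B [_ HB]] : \forall x \near -oo, `|f x| <= 1.
  by move/cvgr0Pnorm_le : fnoo; apply.
have : bounded_set (f @` `[B, A]).
  apply: compact_bounded; apply: continuous_compact; last exact: segment_compact.
  exact: continuous_subspaceT.
move=> [M0 [_ /(_ (M0 + 1))]]; rewrite ltrDl ltr01 => /(_ isT).
set M := M0 + 1 => HM.
exists (Num.max 1 M) => x; rewrite le_max.
have [xA|Ax] := leP x A; last by rewrite HA.
have [xB|Bx] := ltP x B; first by rewrite HB.
by rewrite orbC HM//=; exists x => //=; rewrite in_itv/= Bx.
Qed.

(** Close points are handled by uniform continuity; for [y] at distance at least [dl], the trivial
    bound [2 * M] is below the quadratic term. In this form only the second moment of a kernel is
    needed to average [f]. *)
Lemma quadratic_modulus (R : realType) (f : R -> R) (M lo hi e : R) :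
  continuous f -> (forall x, `|f x| <= M) -> 0 < e ->
  exists2 C, 0 <= C & forall x y, lo <= x <= hi ->
    `|f y - f x| <= e + C * (y - x) ^+ 2.
Proof.
move=> cf fM e0.
have M0 : 0 <= M by apply: le_trans (fM 0).
have [dl dl0 Hd] : exists2 dl, 0 < dl & forall x y, lo <= x <= hi ->
    `|y - x| < dl -> `|f y - f x| <= e.
  have /compact_near_coveringP/(_ _ (0^'+ : set_system R)
      (fun dl x => forall y, `|y - x| < dl -> `|f y - f x| <= e)) := @segment_compact R lo hi.
  case.
    move=> x _.
    have e2 : 0 < e / 2 by rewrite divr_gt0.
    have /cvgrPdist_lt/(_ _ e2) := cf x.
    move=> /nbhs_ballP[r /= r0 Hr].
    have r2 : 0 < r / 2 by rewrite divr_gt0.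
    (* With half radii, both [x'] and any [y] within [t] of it stay within [r] of [x], where [f]
       varies by less than [e / 2]. *)
    exists (ball x (r / 2), [set t : R | t < r / 2]).
      split; first exact: nbhsx_ballx.
      by apply: nbhs_right_lt.
    move=> [x' t] /= [xx' tr] y yx'.
    have xx : `|x - x'| < r / 2 by [].
    have b1 : ball x r x' by apply: le_ball xx'; lra.
    have b2 : ball x r y.
      rewrite /ball /=.
      have -> : x - y = (x - x') + - (y - x') by ring.
      by rewrite (le_lt_trans (ler_normD _ _))// normrN; lra.
    have h1 := Hr _ b1; have h2 := Hr _ b2.
    have -> : f y - f x' = (f x - f x') + - (f x - f y) by ring.
    by rewrite (le_trans (ler_normD _ _))// normrN; lra.
  move=> r /= r0 Hr; exists (r / 2); first by rewrite divr_gt0.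
  move=> x y xlh yx; apply: (Hr (r / 2)) => //=.
  - by rewrite sub0r normrN gtr0_norm ?divr_gt0//; lra.
  - by rewrite divr_gt0.
have Mdl : 0 <= 2 * M / dl ^+ 2.
  by rewrite divr_ge0 ?exprn_ge0 ?(ltW dl0)// mulr_ge0.
exists (2 * M / dl ^+ 2) => //.
move=> x y xlh; have [yx|yx] := ltP `|y - x| dl.
  by rewrite (le_trans (Hd _ _ xlh yx))// lerDl mulr_ge0// sqr_ge0.
have H : 1 <= (y - x) ^+ 2 / dl ^+ 2.
  rewrite ler_pdivlMr ?exprn_gt0// mul1r -(real_normK (num_real (y - x))).
  by rewrite lerXn2r// nnegrE ltW.
rewrite (le_trans (ler_normB _ _))//.
have := fM x; have := fM y => h1 h2.
have : 2 * M * 1 <= 2 * M * ((y - x) ^+ 2 / dl ^+ 2) by rewrite ler_wpM2l// mulr_ge0.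
by move=> h3; rewrite mulrAC -mulrA; lra.
Qed.

(** * Averages of functions against the integer-shape kernel *)

Section ErlangAverage.
Variable R : realType.
Implicit Types (h v e C : R) (m : nat).
Local Notation mu := (@lebesgue_measure R).
Local Notation D := (`[0, +oo[%classic : set R).

Let mD k h (q : R -> R) : measurable_fun setT q ->
  measurable_fun D (fun y => (q y * erlang h k y)%:E).
Proof.
move=> mq; apply/measurable_EFinP; apply: measurable_funM.
  exact: measurable_funTS.
exact: measurable_erlang.
Qed.

Let D0 k h (q : R -> R) : 0 < h -> (forall y, 0 <= q y) ->
  forall y, D y -> (0 <= (q y * erlang h k y)%:E)%E.
Proof.
by move=> h0 q0 y; rewrite /= in_itv/= andbT => y0; rewrite lee_fin mulr_ge0 ?erlang_ge0.
Qed.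

Lemma integral_erlangZ h m (c : R) : 0 < h -> 0 <= c ->
  (\int[mu]_(y in D) (c * erlang h m y)%:E = c%:E)%E.
Proof.
move=> h0 c0; under eq_integral do rewrite EFinM.
rewrite ge0_integralZl_EFin ?integral_erlang ?mule1//.
  by move=> y; rewrite /= in_itv/= andbT => y0; rewrite lee_fin erlang_ge0.
by apply/measurable_EFinP; exact: measurable_erlang.
Qed.

(** The centre [m * h] is the grid point, not the mean [(m + 1) * h]: the variance [h^2 * (m + 1)]
    gains a squared bias [h^2]. Powers of [y] are absorbed by [mul_erlang], which shifts the
    index. *)
Lemma erlang_second_moment h m : 0 < h ->
  (\int[mu]_(y in D) ((y - m%:R * h) ^+ 2 * erlang h m y)%:E =
   (h ^+ 2 * (m%:R + 2))%:E)%E.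
Proof.
move=> h0; set I := LHS.
have m0 : (0 : R) <= m%:R by [].
have mh : 0 <= m%:R * h by rewrite mulr_ge0// ltW.
have msq : measurable_fun setT (fun y : R => (y - m%:R * h) ^+ 2).
  by apply: measurable_funX; apply: measurable_funB.
set a := 2 * (m%:R * h) * (h * m.+1%:R).
set b := h * m.+1%:R * (h * m.+2%:R).
set c := (m%:R * h) ^+ 2.
have a0 : 0 <= a by rewrite !mulr_ge0// ltW.
have b0 : 0 <= b by rewrite !mulr_ge0// ltW.
have c0 : 0 <= c by rewrite sqr_ge0.
(* The cross term of the square is put on the left to keep all integrands nonnegative. *)
have E : (I + a%:E = b%:E + c%:E)%E.
  rewrite -(integral_erlangZ m.+1 h0 a0) -(integral_erlangZ m.+2 h0 b0).
  rewrite -(integral_erlangZ m h0 c0) /I.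
  rewrite -!ge0_integralD//.
  - apply: eq_integral => y _; rewrite -!EFinD; congr EFin.
    have E1 := mul_erlang m y h0; have E2 := mul_erlang m.+1 y h0.
    have E3 : y * (y * erlang h m y) = h * m.+1%:R * (h * m.+2%:R * erlang h m.+2 y).
      by rewrite E1 mulrCA E2.
    have -> : b * erlang h m.+2 y = y * (y * erlang h m y) by rewrite E3 /b; ring.
    have -> : a * erlang h m.+1 y = 2 * (m%:R * h) * (y * erlang h m y).
      by rewrite E1 /a; ring.
    by rewrite /c; ring.
  - by apply: D0.
  - by apply: mD.
  - by apply: D0.
  - by apply: mD.
  - by apply: D0 => // y; exact: sqr_ge0.
  - by apply: mD.
  - by apply: D0.
  - by apply: mD.
have -> : h ^+ 2 * (m%:R + 2) = b + c - a.
  by rewrite /a /b /c -!natr1; ring.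
by rewrite EFinB EFinD -E addeK.
Qed.

Lemma erlang_average_near h m (q : R -> R) v e C :
  0 < h -> measurable_fun setT q -> (forall y, 0 <= q y) ->
  0 <= v -> 0 <= e -> 0 <= C ->
  (forall y, 0 <= y -> `|q y - v| <= e + C * (y - m%:R * h) ^+ 2) ->
  let B := e + C * (h ^+ 2 * (m%:R + 2)) in
  (v%:E <= \int[mu]_(y in D) (q y * erlang h m y)%:E + B%:E)%E /\
  (\int[mu]_(y in D) (q y * erlang h m y)%:E <= (v + B)%:E)%E.
Proof.
move=> h0 mq q0 v0 e0 C0 qv B.
have msq : measurable_fun setT (fun y : R => C * (y - m%:R * h) ^+ 2).
  by apply: measurable_funM => //; apply: measurable_funX; apply: measurable_funB.
have sq0 y : 0 <= C * (y - m%:R * h) ^+ 2 by rewrite mulr_ge0// sqr_ge0.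
have key c : 0 <= c -> (\int[mu]_(y in D) ((c + C * (y - m%:R * h) ^+ 2) * erlang h m y)%:E
   = (c + C * (h ^+ 2 * (m%:R + 2)))%:E)%E.
  move=> c0; under eq_integral do rewrite mulrDl EFinD.
  rewrite ge0_integralD//.
  - rewrite integral_erlangZ// EFinD; congr (_ + _)%E.
    under eq_integral do rewrite -mulrA EFinM.
    rewrite ge0_integralZl_EFin ?erlang_second_moment//.
      by apply: D0 => // y; exact: sqr_ge0.
    by apply: mD; apply: measurable_funX; apply: measurable_funB.
  - by apply: D0.
  - by apply: mD.
  - by apply: D0.
  - by apply: mD.
split.
- rewrite -(integral_erlangZ m h0 v0) -(key _ e0) -ge0_integralD//; last 4 first.
  - by apply: D0.
  - by apply: mD.
  - by apply: D0 => // y; rewrite addr_ge0.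
  - by apply: mD; apply: measurable_funD.
  apply: ge0_le_integral => //.
  - by apply: D0.
  - by apply: mD.
  - apply: emeasurable_funD; apply: mD => //; exact: measurable_funD.
  - move=> y; rewrite /= in_itv/= andbT => y0.
    rewrite -EFinD lee_fin -mulrDl ler_wpM2r ?erlang_ge0//.
    by have := qv _ y0; rewrite distrC => /ler_normlW; lra.
- rewrite addrA -(key _ (addr_ge0 v0 e0)).
  apply: ge0_le_integral => //.
  - by apply: D0.
  - by apply: mD.
  - by apply: mD; apply: measurable_funD.
  - move=> y; rewrite /= in_itv/= andbT => y0.
    rewrite lee_fin ler_wpM2r ?erlang_ge0//.
    by have /ler_normlW := qv _ y0; lra.
Qed.

End ErlangAverage.

(** * Almost sure concentration on the grid *)

(** The first Borel-Cantelli lemma; summability comes from the telescoping bound of [1 / n^2] by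
    [1 / (k + 1) - 1 / (k + 2)], the shift by [N + 2] making it valid from [k = 0]. *)
Lemma borel_cantelli_quadratic d (T : measurableType d) (R : realType)
    (P : probability T R) (F : nat -> set T) (c : R) (N : nat) :
  (forall n, measurable (F n)) -> 0 <= c ->
  (forall n, (N <= n)%N -> (P (F n) <= (c / n%:R ^+ 2)%:E)%E) ->
  {ae P, forall w, \forall n \near \oo, ~ F n w}.
Proof.
move=> mF c0 PF.
pose G k := F (k + N.+2)%N.
have mG k : measurable (G k) by exact: mF.
have PG k : (P (G k) <= (c * (k.+1%:R^-1 - k.+2%:R^-1))%:E)%E.
  have Nk : (N <= k + N.+2)%N by apply: leq_trans (leq_addl k N.+2); rewrite !leqW.
  have k2 : (k.+2 <= k + N.+2)%N by rewrite addnS ltnS addnS ltnS leq_addr.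
  apply: (le_trans (PF _ Nk)).
  move: (k + N.+2)%N k2 => M k2.
  rewrite lee_fin ler_wpM2l//.
  have -> : k.+1%:R^-1 - k.+2%:R^-1 = (k.+1%:R * k.+2%:R)^-1 :> R.
    have a1 : (k.+1%:R : R) != 0 by [].
    have a2 : (k.+2%:R : R) != 0 by [].
    move: a1 a2; rewrite -[k.+2%:R]natr1; move: (k.+1%:R : R) => x x0 x1.
    by field; rewrite x0 x1.
  have M0 : (0 : R) < M%:R by rewrite ltr0n (leq_trans _ k2).
  rewrite lef_pV2 ?posrE ?mulr_gt0 ?exprn_gt0//.
  by rewrite expr2 ler_pM// ler_nat// ltnW.
have sumG : (\sum_(n <oo) P (G n) < +oo)%E.
  apply: (@le_lt_trans _ _ c%:E); last exact: ltry.
  apply: lime_le; first exact: is_cvg_nneseries.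
  apply: nearW => n.
  apply: (@le_trans _ _ (\sum_(0 <= k < n) (c * (k.+1%:R^-1 - k.+2%:R^-1))%:E)%E).
    by apply: lee_sum => k _; exact: PG.
  rewrite sumEFin lee_fin -big_distrr/=.
  have -> : \sum_(0 <= k < n) (k.+1%:R^-1 - k.+2%:R^-1) = 1 - n.+1%:R^-1 :> R.
    elim: n => [|n IH]; first by rewrite big_nil invr1 subrr.
    by rewrite big_nat_recr//= IH addrA subrK.
  by rewrite ler_piMr// gerBl invr_ge0.
have P0 := lim_sup_set_cvg0 mG sumG.
exists (lim_sup_set G); split => //.
  apply: bigcap_measurable => // k _; exact: bigcup_measurable.
move=> w /= nw; rewrite /lim_sup_set /= => k _.
apply: contrapT => nG; apply: nw.
exists (k + N.+2)%N => // n /= kn.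
have kn' : (N.+2 <= n)%N by rewrite (leq_trans _ kn)// leq_addl.
move=> Fn; apply: nG; exists (n - N.+2)%N => /=; last by rewrite /G subnK.
by rewrite leq_subRL// addnC.
Qed.

(** * Conditional means of functions with values in the unit interval *)

Section CondMean.
Context d (T : measurableType d) (R : realType) (P : probability T R).
Variable gen : set (set T).
Hypothesis gen_meas : <<s gen >> `<=` measurable.
Variables (X : T -> R) (g : T -> R -> R).
Hypothesis mX : measurable_fun setT X.
Hypothesis gX : is_cond_density P <<s gen >> X g.

(** The event [C'] where the mass exceeds 1 lies in the sub-sigma-algebra, so the mass and the
    constant 1 have the same integral over it. The excess is positive on [C'] with integral 0, hence
    [C'] is null. *)
Lemma cond_density_mass_le1 :
  {ae P, forall w, (\int[lebesgue_measure]_y (g w y)%:E <= 1)%E}.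
Proof.
have [mZ ZE] := cond_density_integral gen_meas mX gX
  (p := fun=> 1%E) (measurable_cst _) (fun=> lee01).
set Z := fun w : T => _ in mZ.
have ZgE w : (\int[lebesgue_measure]_y (g w y)%:E = Z w)%E.
  by apply: eq_integral => y _; rewrite mul1e.
have mZT : measurable_fun [set: T] Z := measurable_fun_sub_sigma gen_meas mZ.
pose C' := [set w | (1 < Z w)%E].
have GC : <<s gen >> C'.
  have -> : C' = Z @^-1` [set x | (1 < x)%E] by [].
  rewrite -[X in <<s gen >> X]setTI; apply: mZ => //.
  have -> : [set x : \bar R | (1 < x)%E] = `]1%E, +oo[%classic.
    by apply/seteqP; split => x; rewrite /= in_itv/= andbT.
  exact: emeasurable_itv.
have mC := gen_meas GC.
have E1 := ZE _ GC.
have I0 : (\int[P]_(w in C') (Z w - 1) = 0)%E.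
  (* The constant is added back before subtracting, so only nonnegative integrals are split and only
     a finite one is cancelled. *)
  have E2 : (\int[P]_(w in C') (Z w - 1) + \int[P]_(w in C') 1 = \int[P]_(w in C') 1)%E.
    rewrite -[RHS]E1 -ge0_integralD//.
    - by apply: eq_integral => w _; rewrite subeK.
    - by move=> w Z1; rewrite suber_ge0//; exact: ltW.
    - by apply: emeasurable_funB => //; exact: measurable_funTS.
  have PC : (\int[P]_(w in C') 1 \is a fin_num)%E.
    by rewrite integral_cst// mul1e fin_num_measure.
  by rewrite -[LHS](addeK _ PC) E2 subee.
have : ae_eq P C' (fun w => Z w - 1)%E (cst 0%E).
  apply/ae_eq_integral_abs => //.
    by apply: emeasurable_funB => //; exact: measurable_funTS.
  rewrite -[RHS]I0; apply: eq_integral => w; rewrite inE => Z1.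
  by rewrite gee0_abs// suber_ge0//; exact: ltW.
case=> A [mA A0 sub].
exists A; split => // w /= nw; apply: sub => /= H; apply: nw.
rewrite ZgE leNgt; apply/negP => Z1.
have H0 : (Z w - 1 = 0)%E := H Z1.
by move: Z1; rewrite -[Z w](@subeK _ _ 1%E)// H0 add0e ltxx.
Qed.

(* Truncation at 1 because [g w] may have mass larger than 1 for w in a null
   set. *)
Definition cond_mean (p : R -> R) w : R :=
  fine (mine (\int[lebesgue_measure]_y ((p y)%:E * (g w y)%:E)) 1)%E.

Variable p : R -> R.
Hypothesis mp : measurable_fun setT p.
Hypothesis p01 : forall y, 0 <= p y <= 1.

Let I w : \bar R := (\int[lebesgue_measure]_y ((p y)%:E * (g w y)%:E))%E.

Let I0 w : (0 <= I w)%E.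
Proof.
have [_ g0 _] := gX.
apply: integral_ge0 => y _; rewrite mule_ge0// lee_fin //.
by case/andP: (p01 y).
Qed.

Let min_fin w : mine (I w) 1%E \is a fin_num.
Proof.
rewrite ge0_fin_numE; last by rewrite le_min I0 lee01.
by rewrite gt_min ltry orbT.
Qed.

Lemma cond_mean_01 w : 0 <= cond_mean p w <= 1.
Proof.
rewrite /cond_mean -!lee_fin fineK; last exact: min_fin.
by rewrite le_min I0 lee01 ge_min lexx orbT.
Qed.

Lemma cond_meanE w : (\int[lebesgue_measure]_y (g w y)%:E <= 1)%E ->
  (cond_mean p w)%:E = I w.
Proof.
have [mg g0 _] := gX.
move=> g1; rewrite /cond_mean fineK; last exact: min_fin.
apply/min_idPl; apply: le_trans g1.
apply: ge0_le_integral => //.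
- by move=> y _; rewrite mule_ge0// lee_fin //; case/andP: (p01 y).
- by apply: emeasurable_funM; apply/measurable_EFinP; [exact: mp|exact: mg].
- by apply/measurable_EFinP; exact: mg.
- by move=> y _; rewrite -EFinM lee_fin ler_piMl//; case/andP: (p01 y).
Qed.

Lemma measurable_cond_mean : measurable_fun [set: g_sigma_algebraType gen]
  (cond_mean p : g_sigma_algebraType gen -> R).
Proof.
have p0 y : (0 <= (p y)%:E)%E by rewrite lee_fin; case/andP: (p01 y).
have mpE : measurable_fun setT (EFin \o p) by exact/measurable_EFinP.
have [mI _] := cond_density_integral gen_meas mX gX mpE p0.
apply: (@measurableT_comp _ _ _ _ _ _ (@fine R)) => //.
by apply: measurable_mine => //; exact: measurable_cst.
Qed.

Lemma integral_cond_mean C : <<s gen >> C ->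
  (\int[P]_(w in C) (p (X w))%:E = \int[P]_(w in C) (cond_mean p w)%:E)%E.
Proof.
move=> GC; have mC := gen_meas GC.
have p0 y : (0 <= (p y)%:E)%E by rewrite lee_fin; case/andP: (p01 y).
have mpE : measurable_fun setT (EFin \o p) by exact/measurable_EFinP.
have [mI IE] := cond_density_integral gen_meas mX gX mpE p0.
rewrite -(IE C GC); apply: ae_eq_integral => //.
- exact: measurable_funTS (measurable_fun_sub_sigma gen_meas mI).
- apply/measurable_EFinP; apply: measurable_funTS.
  exact: (measurable_fun_sub_sigma gen_meas measurable_cond_mean).
- have := cond_density_mass_le1; apply: filterS => w g1 _.
  by rewrite cond_meanE.
Qed.

End CondMean.

(** * Extended-real suprema and uniform convergence *)

Section SupOn.
Variable R : realType.
Implicit Types (D : set R) (u : R -> R).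

Lemma sup_on_ub D u x : D x -> (`|u x|%:E <= sup_on D u)%E.
Proof. by move=> Dx; apply: ereal_sup_ubound; exists x. Qed.

Lemma sup_on_le D u (e : R) :
  (forall x, D x -> `|u x| <= e) -> (sup_on D u <= e%:E)%E.
Proof. by move=> ue; apply: ge_ereal_sup => _ [x Dx <-]; rewrite lee_fin ue. Qed.

(** A point of [D] makes the supremum nonnegative; over the empty set it would be minus infinity. *)
Lemma sup_on_cvg0P D (u : nat -> R -> R) : D !=set0 ->
  (sup_on D (u n) @[n --> \oo] --> 0%E) <->
  (forall e, 0 < e -> \forall n \near \oo, forall x, D x -> `|u n x| <= e).
Proof.
move=> [x0 Dx0]; split=> [/fine_cvgP[fin cv] e e0|H].
  have cv' := (cvgrPdist_le _ _).1 cv _ e0.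
  near=> n => x Dx.
  have finn : sup_on D (u n) \is a fin_num by near: n; exact: fin.
  have : `|0 - fine (sup_on D (u n))| <= e by near: n; exact: cv'.
  rewrite sub0r normrN => /ler_normlW; apply: le_trans.
  by rewrite -lee_fin fineK//; exact: sup_on_ub.
have sup0 n : (0 <= sup_on D (u n))%E.
  by apply: le_trans (sup_on_ub (u n) Dx0); rewrite lee_fin.
apply/fine_cvgP; split.
  near=> n; rewrite ge0_fin_numE//.
  apply: (@le_lt_trans _ _ 1%:E); last exact: ltry.
  by apply: sup_on_le; near: n; exact: H.
apply/cvgrPdist_le => e e0; near=> n.
have : (sup_on D (u n) <= e%:E)%E.
  by apply: sup_on_le; near: n; exact: H.
move: (sup0 n) => /=; case: sup_on => //= r; rewrite ?lee_fin// => r0 re.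
by rewrite sub0r normrN ger0_norm.
Unshelve. all: by end_near. Qed.

End SupOn.

(** * Sigma-algebras of the past *)

Section Past.
Context d (T : measurableType d) (R : realType) (P : probability T R).
Variables X Y : int -> {RV P >-> R}.

(** The generators of [past] for the pair process, named so that measurability can be stated on
    [g_sigma_algebraType]. *)
Definition past_gen (t : int) : set (set T) :=
  [set A | exists (s : int) (B : set (R * R)),
    [/\ (s <= t)%R, measurable B & A = (fun w => (X s w, Y s w)) @^-1` B]].

Lemma past_gen_measurable t : <<s past_gen t >> `<=` measurable.
Proof.
apply: smallest_sub; first exact: sigma_algebra_measurable.
move=> _ [s [B [_ mB ->]]]; rewrite -[X in measurable X]setTI.
by apply: measurable_fun_pair => //; exact: measurable_funP.
Qed.

Lemma past_gen_mono s t : (s <= t)%R -> <<s past_gen s >> `<=` <<s past_gen t >>.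
Proof.
move=> st; apply: sub_smallest2r; first exact: smallest_sigma_algebra.
move=> _ [r [B [rs mB ->]]].
by exists r, B; split => //; exact: le_trans st.
Qed.

Lemma measurable_past_gen t :
  measurable_fun [set: g_sigma_algebraType (past_gen t)]
    (X t : g_sigma_algebraType (past_gen t) -> R).
Proof.
move=> _ B mB; rewrite setTI; apply: sub_sigma_algebra.
exists t, (B `*` setT); split => //; first exact: measurableX.
by apply/seteqP; split => w /=; [move=> ?; split|case].
Qed.

End Past.

Section Concentration.
Context d (T : measurableType d) (R : realType) (P : probability T R).
Variables X Y : int -> {RV P >-> R}.
Variable g : int -> T -> R -> R.
Hypothesis g_density : forall t,
  is_cond_density P (past (fun s w => (X s w, Y s w)) (t - 1)) (X t) (g t).

(** The kernel times [h], extended by 0 to negative [y], so that it takes values in the unit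
    interval everywhere. *)
Definition pois_weight m (h y : R) : R := pois m (y / h) * \1_(`[0, +oo[) y.

Lemma pois_weight01 m h y : 0 < h -> 0 <= pois_weight m h y <= 1.
Proof.
move=> h0; rewrite /pois_weight indicE; case: (boolP (y \in _)); last first.
  by rewrite mulr0 lexx ler01.
rewrite inE /= in_itv /= andbT mulr1 => y0.
by rewrite pois_ge0 ?pois_le1// divr_ge0// ltW.
Qed.

Lemma measurable_pois_weight m h : measurable_fun setT (pois_weight m h).
Proof.
apply: measurable_funM; last exact: measurable_indic.
apply: (measurableT_comp (measurable_pois m)).
exact: measurable_funM.
Qed.

(** Index [t] stands for time [t + 1]: the past of that observation is the sigma-algebra of index
    [t]. *)
Definition weight_sum m h n w : R := \sum_(t < n) pois_weight m h (X t.+1%:Z w).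

Definition cond_weight_sum m h n w : R :=
  \sum_(t < n) cond_mean (g t.+1%:Z) (pois_weight m h) w.

Let bad m h eta a n :=
  [set w | (2 * eta * cond_weight_sum m h n w + eta * a
            < `|weight_sum m h n w - cond_weight_sum m h n w|)%R].

Let gen (t : nat) := past_gen X Y t%:Z.

Let g_density' (t : nat) : is_cond_density P <<s gen t >> (X t.+1%:Z) (g t.+1%:Z).
Proof. by have := g_density t.+1%:Z; rewrite intS addrC addKr. Qed.

Let gen_meas t : <<s gen t >> `<=` measurable.
Proof. exact: past_gen_measurable. Qed.

Let mX t : measurable_fun [set: T] (X t) := measurable_funP (X t).

Let mkap m h t : measurable_fun [set: g_sigma_algebraType (gen t.+1)]
  ((fun w => pois_weight m h (X t.+1%:Z w)) : g_sigma_algebraType (gen t.+1) -> R).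
Proof.
apply: measurableT_comp; first exact: measurable_pois_weight.
exact: measurable_past_gen.
Qed.

Let mmu m h t : 0 < h -> measurable_fun [set: g_sigma_algebraType (gen t)]
  (cond_mean (g t.+1%:Z) (pois_weight m h) : g_sigma_algebraType (gen t) -> R).
Proof.
move=> h0; apply: (measurable_cond_mean (@gen_meas t) (@mX _) (g_density' t)).
  exact: measurable_pois_weight.
by move=> y; exact: pois_weight01.
Qed.

Lemma weight_sum_chernoff m h eta a n : 0 < h -> 0 < eta <= 1/2 ->
  (P (bad m h eta a n) <= (2 * expR (- (eta ^+ 2 * a)))%:E)%E.
Proof.
move=> h0 e2.
apply: (@martingale_chernoff _ _ _ P gen gen_meas _
  (fun t w => pois_weight m h (X t.+1%:Z w))
  (fun t => cond_mean (g t.+1%:Z) (pois_weight m h))) => //.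
- by move=> s t st; apply: past_gen_mono; rewrite lez_nat.
- by move=> t w; exact: pois_weight01.
- move=> t w; apply: (cond_mean_01 (g_density' t)) => y; exact: pois_weight01.
- by move=> t; exact: (@mmu m h t h0).
- move=> t C GC.
  exact: (integral_cond_mean (@gen_meas t) (@mX _) (g_density' t)
    (measurable_pois_weight m h) (fun y => pois_weight01 m y h0) GC).
Qed.

Lemma measurable_weight_sum_deviation m h eta a n : 0 < h -> measurable (bad m h eta a n).
Proof.
move=> h0.
have mS : measurable_fun [set: T] (weight_sum m h n).
  apply: measurable_sum => t.
  exact: (measurable_fun_sub_sigma (@gen_meas t.+1) (@mkap m h t)).
have mM : measurable_fun [set: T] (cond_weight_sum m h n).
  apply: measurable_sum => t.
  exact: (measurable_fun_sub_sigma (@gen_meas t) (@mmu m h t h0)).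
rewrite -[X in measurable X]setTI.
have -> : bad m h eta a n = (fun w => `|weight_sum m h n w - cond_weight_sum m h n w|
    - (2 * eta * cond_weight_sum m h n w + eta * a)) @^-1` `]0, +oo[.
  by apply/seteqP; split => w; rewrite /bad /= in_itv/= andbT subr_gt0.
have mf : measurable_fun [set: T] (fun w => `|weight_sum m h n w - cond_weight_sum m h n w|
    - (2 * eta * cond_weight_sum m h n w + eta * a)).
  apply: measurable_funB.
    by apply: measurableT_comp => //; apply: measurable_funB.
  by apply: measurable_funD => //; apply: measurable_funM.
exact: mf.
Qed.

Variable h : nat -> R.
Hypothesis h_gt0 : forall n, 0 < h n.
Hypothesis h_rate : n%:R * h n / ln n%:R @[n --> \oo] --> +oo%R.

Lemma rate_ge_ln (A : R) : \forall n \near \oo, A * ln n%:R <= n%:R * h n.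
Proof.
near=> n.
have n2 : (2 <= n)%N by near: n; exact: nbhs_infty_ge.
have l0 : 0 < ln n%:R :> R by rewrite ln_gt0// ltr1n.
rewrite -ler_pdivlMr//; near: n.
by move/cvgryPge : h_rate; exact.
Unshelve. all: by end_near. Qed.

Lemma rate_ge1 : \forall n \near \oo, 1 <= n%:R * h n.
Proof.
near=> n.
have n2 : (2 <= n)%N by near: n; exact: nbhs_infty_ge.
have l2 : 0 < ln 2%:R :> R by rewrite ln_gt0// ltr1n.
(* This product is at least 1 as soon as [n >= 2]. *)
apply: (@le_trans _ _ ((ln 2%:R)^-1 * ln n%:R)); last first.
  by near: n; exact: rate_ge_ln.
rewrite mulrC ler_pdivlMr// mul1r ler_ln ?posrE ?ltr0n ?ler_nat//.
exact: leq_trans n2.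
Unshelve. all: by end_near. Qed.

(* The grid has at most n^2 + 1 points, and n h_n >= (4 / eta^2) ln n makes each
   deviation probability at most 2 n^-4. *)
Lemma weight_sum_as eta : 0 < eta <= 1/2 ->
  {ae P, forall w, \forall n \near \oo, forall m, (m <= n ^ 2)%N ->
    `|weight_sum m (h n) n w - cond_weight_sum m (h n) n w| <=
    2 * eta * cond_weight_sum m (h n) n w + eta * (n%:R * h n)}.
Proof.
move=> e2; have /andP[e0 _] := e2.
pose F n := \big[setU/set0]_(m < (n ^ 2).+1) bad m (h n) eta (n%:R * h n) n.
have mF n : measurable (F n).
  by apply: bigsetU_measurable => m _; exact: measurable_weight_sum_deviation.
have [N _ HN] : \forall n \near \oo, (1 <= n)%N /\ 4 / eta ^+ 2 * ln n%:R <= n%:R * h n.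
  near=> n; split; near: n; [exact: nbhs_infty_ge|exact: rate_ge_ln].
have PF n : (N <= n)%N -> (P (F n) <= (4 / n%:R ^+ 2)%:E)%E.
  move=> /HN[n1 hn].
  have n0 : (0 : R) < n%:R by rewrite ltr0n.
  apply: (@le_trans _ _ (\sum_(m < (n ^ 2).+1) P (bad m (h n) eta (n%:R * h n) n))).
    apply: (@content_subadditive _ _ _ P (F n)
      (fun m => bad m (h n) eta (n%:R * h n) n) (n ^ 2).+1) => //.
    by move=> m _; exact: measurable_weight_sum_deviation.
  apply: (@le_trans _ _ (\sum_(m < (n ^ 2).+1) (2 / n%:R ^+ 4)%:E)%E).
    apply: lee_sum => m _.
    apply: (le_trans (weight_sum_chernoff _ _ _ _ _)) => //.
    rewrite lee_fin ler_wpM2l//.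
    rewrite expRN lef_pV2 ?posrE ?exprn_gt0 ?expR_gt0//.
    have -> : n%:R ^+ 4 = expR (4 * ln n%:R) :> R.
      by rewrite (expRM_natl 4) lnK.
    rewrite ler_expR.
    have := ler_wpM2l (sqr_ge0 eta) hn.
    rewrite !mulrA (mulrC _ 4) -(mulrA 4) mulfV ?mulr1 ?mulrA//.
    by rewrite expf_neq0// gt_eqF.
  rewrite sumEFin lee_fin sumr_const card_ord -[leLHS]mulr_natl.
  (* Since [n^2 + 1 <= 2 n^2], the union bound over the grid gives [4 / n^2]. *)
  have n1' : (1 : R) <= n%:R ^+ 2 by rewrite exprn_ege1// ler1n.
  have -> : 4 / n%:R ^+ 2 = (2 * n%:R ^+ 2) * (2 / n%:R ^+ 4) :> R.
    by field; rewrite gt_eqF.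
  rewrite ler_wpM2r ?divr_ge0 ?exprn_ge0// -natr1 natrX; lra.
have : {ae P, forall w, \forall n \near \oo, ~ F n w}.
  exact: (@borel_cantelli_quadratic _ _ _ _ _ 4 N).
apply: filterS => w; apply: filterS => n nF m mn.
rewrite leNgt; apply/negP => bd; apply: nF.
rewrite /F -(bigcup_mkord _ (fun m => bad m (h n) eta (n%:R * h n) n)).
by exists m => //=; rewrite ltnS.
Unshelve. all: by end_near. Qed.

End Concentration.

(** * Uniform convergence *)

(** Exchange of a finite sum with the integral; the mass bound ensures that the truncation in
    [cond_mean] is inactive at this [w]. *)
Lemma integral_mean_erlang d (T : measurableType d) (R : realType)
    (P : probability T R) (X Y : int -> {RV P >-> R}) (g : int -> T -> R -> R)
    (g_density : forall t,
      is_cond_density P (past (fun s w => (X s w, Y s w)) (t - 1)) (X t) (g t))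
    m (h : R) n w :
  0 < h -> (0 < n)%N ->
  (forall t : nat, (\int[lebesgue_measure]_y (g t.+1%:Z w y)%:E <= 1)%E) ->
  (\int[lebesgue_measure]_(y in `[0%R, +oo[)
     ((n%:R^-1 * \sum_(1 <= t < n.+1) g t%:Z w y) * erlang h m y)%:E =
   (cond_weight_sum g m h n w / (n%:R * h))%:E)%E.
Proof.
move=> h0 n0 mass.
have n0' : (0 : R) < n%:R by rewrite ltr0n.
have p01 y := pois_weight01 m y h0.
pose G (t : nat) y : \bar R := ((pois_weight m h y)%:E * (g t.+1%:Z w y)%:E)%E.
have mG t : measurable_fun setT (G t).
  have [mg _ _] := g_density t.+1%:Z.
  by apply: emeasurable_funM; apply/measurable_EFinP;
    [exact: measurable_pois_weight|exact: mg].
have G0 t y : (0 <= G t y)%E.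
  have [_ g0 _] := g_density t.+1%:Z.
  by rewrite mule_ge0// lee_fin; [case/andP: (p01 y)|exact: g0].
have -> : (cond_weight_sum g m h n w / (n%:R * h))%:E =
    (((n%:R * h)^-1)%:E * \sum_(t < n) \int[lebesgue_measure]_y G t y)%E.
  rewrite mulrC EFinM; congr (_ * _)%E.
  rewrite /cond_weight_sum -sumEFin; apply: eq_bigr => t _.
  exact: (cond_meanE (g_density _) (measurable_pois_weight m h) p01 (mass _)).
rewrite -ge0_integral_sum//; last by move=> t; exact: mG.
rewrite -ge0_integralZl_EFin//; last 3 first.
- by move=> y _; rewrite sume_ge0.
- by apply: emeasurable_sum => t; exact: mG.
- by rewrite invr_ge0 mulr_ge0// ltW.
rewrite [LHS]integral_mkcond; apply: eq_integral => y _.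
rewrite patchE; case: ifPn => yD.
  rewrite /G -ge0_sume_distrr; last first.
    by move=> t _; have [_ g0 _] := g_density t.+1%:Z; rewrite lee_fin g0.
  rewrite sumEFin -!EFinM; congr EFin.
  rewrite /pois_weight indicE yD mulr1 /erlang big_add1 big_mkord /=.
  by field; rewrite !gt_eqF.
rewrite /G big1 ?mule0// => t _.
by rewrite /pois_weight indicE (negbTE yD) mulr0 mul0e.
Qed.

Lemma mean_erlang_weight_sum d (T : measurableType d) (R : realType)
    (P : probability T R) (X : int -> {RV P >-> R}) m (h : R) n w :
  0 < h -> (forall t, 0 <= X t w) ->
  n%:R^-1 * (\sum_(1 <= t < n.+1) erlang h m (X t%:Z w)) =
  weight_sum X m h n w / (n%:R * h).
Proof.
move=> h0 X0; rewrite big_add1 big_mkord /= /weight_sum [RHS]mulrC.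
rewrite !big_distrr; apply: eq_bigr => t _ /=.
rewrite /pois_weight indicE mem_set/= ?in_itv/= ?X0// mulr1 /erlang invfM.
by ring.
Qed.

Theorem theorem3p1 (d : measure_display) (T : measurableType d) (R : realType)
    (P : probability T R) (X Y : int -> {RV P >-> R})
    (X_ge0 : forall t w, 0 <= X t w) (Y_ge0 : forall t w, 0 <= Y t w)
    (stat : strictly_stationary P (fun t w => (X t w, Y t w)))
    (erg : ergodic P (fun t w => (X t w, Y t w)))
    (X_ac : forall t, distribution P (X t) `<< @lebesgue_measure R)
    (Y_ac : forall t, distribution P (Y t) `<< @lebesgue_measure R)
    (f : R -> R) (f_density : forall t, is_density (distribution P (X t)) f)
    (h : nat -> R) (h_gt0 : forall n, 0 < h n) (h_cvg0 : h @ \oo --> (0 : R))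
    (a b : R) (a_gt0 : 0 < a) (a_lt_b : a < b)
    (g : int -> T -> R -> R)
    (g_density : forall t,
       is_cond_density P (past (fun s w => (X s w, Y s w)) (t - 1)) (X t) (g t))
    (g_C0 : forall t, {ae P, forall w, C0 (g t w)})
    (f_C0 : C0 f)
    (g_mean : {ae P, forall w,
       sup_on setT
         (fun x => n%:R^-1 * \sum_(1 <= t < n.+1) g t%:Z w x - f x)
         @[n --> \oo] --> 0%E})
    (h_rate : n%:R * h n / ln n%:R @[n --> \oo] --> +oo%R) :
  {ae P, forall w,
     sup_on `[a, b] (fun x => gamma_kde h X n w x - f x) @[n --> \oo] --> 0%E}.
Proof.
have f0 x : 0 <= f x by have [_ + _] := f_density 0; exact.
have [M fM] := C0_bounded f_C0.
have M0 : 0 <= M by apply: le_trans (fM 0).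
have fleM x : f x <= M by exact: le_trans (ler_norm _) (fM x).
have mass : {ae P, forall w, forall t : nat,
    (\int[lebesgue_measure]_y (g t.+1%:Z w y)%:E <= 1)%E}.
  apply: ae_foralln => t.
  exact: (cond_density_mass_le1 (@past_gen_measurable _ _ _ _ X Y _)
    (measurable_funP (X _)) (g_density t.+1%:Z)).
(* The values [1 / (k + 2)] of [eta] are countably many, so one null set serves them all, and they
   never exceed 1/2. *)
have conc : {ae P, forall w, forall k : nat, \forall n \near \oo, forall m, (m <= n ^ 2)%N ->
    `|weight_sum X m (h n) n w - cond_weight_sum g m (h n) n w| <=
    2 * k.+2%:R^-1 * cond_weight_sum g m (h n) n w + k.+2%:R^-1 * (n%:R * h n)}.
  apply: ae_foralln => k; apply: (weight_sum_as g_density h_gt0 h_rate).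
  by rewrite invr_gt0 ltr0n /= div1r lef_pV2 ?posrE// ler_nat.
have hsmall (c r : R) : 0 <= c -> 0 < r -> \forall n \near \oo, c * h n <= r.
  move=> c0 r0; have c1 : 0 < c + 1 by rewrite ltr_wpDl.
  have /cvgr0Pnorm_le/(_ _ (divr_gt0 r0 c1)) := h_cvg0.
  apply: filterS => n; rewrite gtr0_norm// ler_pdivlMr// => hr.
  by apply: le_trans hr; rewrite mulrC ler_wpM2l ?lerDl// ltW.
move: mass conc g_mean; apply: filterS3 => w mass conc gmean.
apply/sup_on_cvg0P; first by exists a; rewrite /= in_itv/= lexx ltW.
have {}gmean := (sup_on_cvg0P _ (ex_intro _ 0 I)).1 gmean.
move=> eps eps0.
(* 19 = 3 * 6 + 1: the grid error [6 * e0] is tripled, and [f x / (m + 1)] adds one more [e0]. *)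
pose e0 := Num.min 1 (eps / 19).
have e00 : 0 < e0 by rewrite lt_min ltr01 divr_gt0.
have e01 : e0 <= 1 by rewrite ge_min lexx.
have e0eps : 19 * e0 <= eps by rewrite mulrC -ler_pdivlMr// ge_min lexx orbT.
have cf : continuous f by have [] := f_C0.
(* The interval contains [[a, b]] and the nearby grid points, which lie within [2 * h n <= 1]. *)
have [C C0 fC] := quadratic_modulus 0 (b + 1) cf fM e00.
(* The deviation is at most [2 * eta * mu + eta] with [mu <= M + 3], and
   [2 * (M + 3) + 1 = 2 * M + 7]. *)
have [k kP] : exists k : nat, k.+2%:R^-1 * (2 * M + 7) <= e0.
  exists (Num.truncn ((2 * M + 7) / e0)).
  rewrite [leLHS]mulrC ler_pdivrMr// [leRHS]mulrC -ler_pdivrMr//.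
  by apply: (le_trans (ltW (truncnS_gt _))); rewrite ler_nat.
set eta := k.+2%:R^-1 in kP.
have eta0 : 0 <= eta by rewrite invr_ge0.
have b0 : 0 < b by exact: lt_trans a_lt_b.
near=> n.
have n0 : (0 < n)%N by near: n; exact: nbhs_infty_gt.
have hn0 := h_gt0 n.
have hn1 : 1 * h n <= 1 / 2 by near: n; exact: hsmall.
have hna : 1 * h n <= a by near: n; exact: hsmall.
have Mh : 2 * M / a * h n <= e0.
  by near: n; apply: hsmall => //; rewrite divr_ge0 ?mulr_ge0// ltW.
have Ch : C * (b + 6) * h n <= e0.
  by near: n; apply: hsmall => //; rewrite mulr_ge0// addr_ge0// ltW.
have rate1 : 1 <= n%:R * h n by near: n; exact: rate_ge1.
have nb : b + 1 <= n%:R by near: n; exact: nbhs_infty_ger.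
have ga y : `|n%:R^-1 * \sum_(1 <= t < n.+1) g t%:Z w y - f y| <= e0.
  have H : forall x : R, [set: R] x ->
      `|n%:R^-1 * \sum_(1 <= t < n.+1) g t%:Z w x - f x| <= e0.
    by near: n; exact: gmean.
  exact: H.
have Dn : forall m, (m <= n ^ 2)%N ->
    `|weight_sum X m (h n) n w - cond_weight_sum g m (h n) n w| <=
    2 * eta * cond_weight_sum g m (h n) n w + eta * (n%:R * h n).
  by near: n; exact: conc.
move=> x; rewrite /= in_itv/= => /andP[ax xb].
have x0 : 0 < x by exact: lt_le_trans ax.
have nh0 : 0 < n%:R * h n by rewrite mulr_gt0// ltr0n.
rewrite mul1r in hn1; rewrite mul1r in hna.
pose k0 := Num.truncn (x / h n).
have xh1 : 1 <= x / h n by rewrite ler_pdivlMr// mul1r; exact: le_trans ax.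
have /andP[kx xk] : k0%:R <= x / h n < k0.+1%:R.
  by apply: truncn_itv; apply: le_trans xh1.
(* The integer part of [x / h n] is positive because [h n <= a <= x]; the lower sandwich needs the
   grid index just below it. *)
have [m k0m] : exists m, k0 = m.+1.
  exists k0.-1; rewrite prednK// lt0n; apply/eqP => k00.
  by move: xk; rewrite k00 ltNge xh1.
rewrite k0m in kx xk.
pose theta := x / h n - m.+1%:R.
have xE : x = (m.+1%:R + theta) * h n.
  by rewrite /theta addrC subrK divfK// gt_eqF.
have t01 : 0 <= theta <= 1.
  rewrite subr_ge0 kx /= lerBlDr.
  by move: xk => /ltW; rewrite -(natr1 m.+1) addrC.
have /andP[t0 t1] := t01.
have near_grid j : (m <= j <= m.+2)%N -> `|j%:R * h n - x| <= 2 * h n.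
  move=> /andP[mj jm].
  have j1 : m%:R <= j%:R :> R by rewrite ler_nat.
  have j2 : j%:R <= m%:R + 2 :> R by rewrite -natrD ler_nat addn2.
  have -> : j%:R * h n - x = (j%:R - (m.+1%:R + theta)) * h n by rewrite xE; ring.
  rewrite normrM (gtr0_norm hn0) ler_wpM2r ?(ltW hn0)//.
  by rewrite ler_norml -natr1; apply/andP; split; lra.
(* The [6 * e0] splits into [e0] for the deviation of [S] from [Mu], [3 * e0] between [mu] and [f]
   at the grid point, and [2 * e0] from there to [x]. *)
have grid j : (m <= j <= m.+2)%N ->
   `|n%:R^-1 * \sum_(1 <= t < n.+1) erlang (h n) j (X t%:Z w) - f x| <= 6 * e0.
  move=> jm; have near_j := near_grid _ jm.
  have jh0 : 0 <= j%:R * h n by rewrite mulr_ge0// ltW.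
  have jhb : j%:R * h n <= b + 1.
    by have := near_j => /ler_normlW; lra.
  (* As [n * h n >= 1], [j] is at most [n * (j * h n)], hence at most [n * (b + 1)]. *)
  have jn2 : (j <= n ^ 2)%N.
    rewrite -(ler_nat R) natrX expr2.
    apply: (@le_trans _ _ (j%:R * (n%:R * h n))); first by rewrite ler_peMr.
    by rewrite mulrCA ler_wpM2l// (le_trans jhb).
  rewrite mean_erlang_weight_sum//.
  set S := weight_sum _ _ _ _ _; set Mu := cond_weight_sum g j (h n) n w.
  have qv y : 0 <= y -> `|n%:R^-1 * \sum_(1 <= t < n.+1) g t%:Z w y - f (j%:R * h n)| <=
      2 * e0 + C * (y - j%:R * h n) ^+ 2.
    move=> y0; have H1 := ga y; have := fC (j%:R * h n) y.
    rewrite jh0 jhb => /(_ isT) H2.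
    rewrite -[X in `|X|](subrKA (f y)) (le_trans (ler_normD _ _))//; lra.
  have mq : measurable_fun setT (fun y => n%:R^-1 * \sum_(1 <= t < n.+1) g t%:Z w y).
    apply: measurable_funM => //; apply: measurable_sum => t.
    by have [mg _ _] := g_density t%:Z; exact: mg.
  have q0 y : 0 <= n%:R^-1 * \sum_(1 <= t < n.+1) g t%:Z w y.
    rewrite mulr_ge0// sumr_ge0// => t _.
    by have [_ g0 _] := g_density t%:Z; exact: g0.
  have e20 : 0 <= 2 * e0 by rewrite mulr_ge0// ltW.
  have [] := erlang_average_near hn0 mq q0 (f0 (j%:R * h n)) e20 C0 qv.
  rewrite (integral_mean_erlang g_density)// -EFinD !lee_fin -/Mu.
  set mu := Mu / _ => L U.
  have CB : C * (h n ^+ 2 * (j%:R + 2)) <= e0.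
    apply: le_trans Ch; rewrite -mulrA ler_wpM2l//.
    have -> : h n ^+ 2 * (j%:R + 2) = (j%:R * h n + 2 * h n) * h n by ring.
    by rewrite ler_wpM2r ?(ltW hn0)//; lra.
  have H : `|S - Mu| / (n%:R * h n) <= 2 * eta * mu + eta.
    have := Dn _ jn2; rewrite -(ler_pM2r (_ : 0 < (n%:R * h n)^-1)) ?invr_gt0//.
    by rewrite mulrDl mulfK ?gt_eqF// -(mulrA (2 * eta)).
  have {}H : `|S / (n%:R * h n) - mu| <= 2 * eta * mu + eta.
    by apply: le_trans H; rewrite -mulrBl normrM (@gtr0_norm _ _^-1) ?invr_gt0.
  have muM : mu <= M + 3 by have := fleM (j%:R * h n); lra.
  have etamu : eta * mu <= eta * (M + 3) by rewrite ler_wpM2l.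
  have fx : `|f (j%:R * h n) - f x| <= 2 * e0.
    have := fC x (j%:R * h n).
    rewrite (ltW x0) (le_trans xb) ?lerDl// => /(_ isT) H3.
    have sq : (j%:R * h n - x) ^+ 2 <= (2 * h n) ^+ 2.
      by rewrite -(real_normK (num_real _)) lerXn2r// nnegrE mulr_ge0// ltW.
    have : C * (j%:R * h n - x) ^+ 2 <= e0.
      apply: le_trans Ch; rewrite -mulrA ler_wpM2l// (le_trans sq)//.
      have -> : (2 * h n) ^+ 2 = (4 * h n) * h n by ring.
      by rewrite ler_wpM2r ?(ltW hn0)//; lra.
    lra.
  move: H fx; rewrite !ler_norml => /andP[h1 h2] /andP[h3 h4].
  apply/andP; split; lra.
have := @gamma_kde_le_erlang R _ T h (fun t => X t) n w m theta (f x) (6 * e0)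
  hn0 (fun t => X_ge0 t w) t01 (f0 x) grid.
rewrite -xE => /le_trans; apply.
have : f x / m.+1%:R <= e0.
  rewrite ler_pdivrMr//; apply: le_trans (fleM x) _.
  have m1 : (0 : R) < m.+1%:R by [].
  (* Since [x] is at most [(m + 2) * h n], the index [m + 1] is at least [a / (2 * h n)], which
     tends to infinity. *)
  have am : a <= 2 * m.+1%:R * h n.
    apply: (le_trans ax); rewrite xE ler_wpM2r ?(ltW hn0)//.
    have : (1 : R) <= m.+1%:R by rewrite ler1n.
    lra.
  apply: le_trans (ler_wpM2r (ltW m1) Mh).
  have -> : 2 * M / a * h n * m.+1%:R = M * ((2 * m.+1%:R * h n) / a) by ring.
  by rewrite ler_peMr// ler_pdivlMr// mul1r.
by move: (f x / m.+1%:R) => q qe; lra.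
Unshelve. all: by end_near. Qed.
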